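(* Let $G$ be a connected $4$-regular multigraph with the triangle property. Then at least one of the following holds: (1) $G$ is (isomorphic to) the squared cycle $C_n^2$ for some $n\ge 3$; or (2) $G$ is (isomorphic to) the $5$-vertex multigraph $F_5$, which is obtained by applying Operation 4 once to the squared $4$-cycle $C_4^2$; or (3) $G$ can be obtained from the line multigraph $L(M)$ of a cubic multigraph $M$ by a (possibly empty) sequence of applications of Operations 1--5.
   Context: Multigraphs are finite and loopless; parallel edges are allowed, and edges count with multiplicity towards degrees. Quartic means $4$-regular, cubic means $3$-regular. A triangle is a set of three edges pairwise joining three distinct vertices. A multigraph has the triangle property if every edge lies in a triangle. Squared cycle: for $n\ge 3$, $C_n^2$ is the Cayley multigraph $\mathrm{Cay}(\mathbb{Z}_n,\{\pm1,\pm2\})$ with the connection set viewed as a multiset; i.e. the vertex set is $\mathbb{Z}_n$ and the number of edges between distinct $a,b$ is the number of elements $s$ of the multiset $\{1,-1,2,-2\}$ with $b-a\equiv s \pmod n$. (So $C_3^2$ is a triangle with every edge doubled, $C_4^2$ is a $4$-cycle with both diagonals added as double edges, and $C_n^2$ is simple for $n\ge5$.) Line multigraph: $L(M)$ has the edges of $M$ as its vertices, and two distinct edges of $M$ are joined by $k$ edges in $L(M)$ if they are mutually incident to exactly $k$ vertices of $M$. The multigraph $F_5$ has vertices $x,y,u,v_1,v_2$, single edges $ux,\ uy,\ uv_1,\ uv_2,\ xv_1,\ yv_2$, a double edge between $v_1$ and $v_2$, and a double edge between $x$ and $y$. Operations on a quartic multigraph $G$ with the triangle property. A triangle $T$ (a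 set of three edges) of $G$ is eligible if it can be removed (deleting its three edges, keeping all vertices and other edges) without destroying the triangle property, or if one of its three edges belongs to a triple edge. In each operation, the named (attachment) vertices are distinct vertices that remain, together with all edges not mentioned; the other vertices of the replaced subgraph are deleted, and the unnamed vertices of the replacing subgraph are new. Operation 1: choose an eligible triangle $\{xy,yz,zx\}$; delete these three edges; add new vertices $u,v,w$ and edges $xu,uy,yw,wz,zv,vx,uv,vw,wu$. Operation 2: choose an eligible triangle $\{xy,yz,zx\}$; delete these three edges; add new vertices $u,v$ and edges $ux,uy,uz,vx,vy,vz,uv$ (a copy of $K_{1,1,3}$). Operation 3 (attachment vertex $x$): replace a subgraph on vertices $x,p,q$ with single edges $xp,xq$ and a triple edge between $p$ and $q$ by the subgraph on vertices $x,p,q,r$ with single edges $xp,xq,pq$ and double edges between $p,r$ and between $q,r$. Operation 4 (attachment vertices $x,y$): replace a subgraph on vertices $x,y,u,v$ with single edges $xu,xv,yu,yv$ and a double edge between $u$ and $v$ by the subgraph on vertices $x,y,u,v_1,v_2$ with single edges $ux,uy,uv_1,uv_2,xv_1,yv_2$ and a double edge between $v_1$ and $v_2$. (It is allowed that $x,y$ are joined by a double edge in $G$, which is kept.) Operation 5 (attachment vertex $x$): replace a subgraph on vertices $x,b,c,d,e$ with single edges $xb,xc,bc,bd,cd,be,ce$ and a double edge between $d$ and $e$ by the subgraph on vertices $x,p,q$ with single edges $xp,xq$ and a triple edge between $p$ and $q$. *)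

(* Defs.v *)
From mathcomp Require Import all_boot all_algebra.

Set Implicit Arguments.
Unset Strict Implicit.
Unset Printing Implicit Defensive.

(* A finite loopless multigraph, given as a multiset of unordered pairs of
   distinct vertices: [mult x y] is the number of edges joining x and y. *)
Record multigraph := Multigraph {
  vert :> finType;
  mult : vert -> vert -> nat;
  multC : forall x y, mult x y = mult y x;
  multxx : forall x, mult x x = 0 }.

Arguments mult {m} x y.
Arguments multC {m} x y.
Arguments multxx {m} x.

Definition isomorphic (G H : multigraph) : Prop :=
  exists2 f : G -> H, bijective f & forall x y, mult (f x) (f y) = mult x y.

Definition adjacent (G : multigraph) : rel G := fun x y => 0 < mult x y.

Definition degree (G : multigraph) (x : G) : nat := \sum_(y : G) mult x y.

Definition regular (k : nat) (G : multigraph) : Prop :=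
  forall x : G, degree x = k.

Definition connected (G : multigraph) : Prop :=
  0 < #|G| /\ forall x y : G, connect (@adjacent G) x y.

(* The three vertices are distinct because there are no loops. *)
Definition triangle (G : multigraph) (x y z : G) : Prop :=
  [/\ adjacent x y, adjacent y z & adjacent z x].

Definition triangle_property (G : multigraph) : Prop :=
  forall x y : G, adjacent x y -> exists z : G, triangle x y z.

(* Number of edges joining a and b in a list of edges; a pair stands for an
   undirected edge. *)
Definition edge_count (T : eqType) (s : seq (T * T)) (a b : T) : nat :=
  if a == b then 0 else count (fun p => (p == (a, b)) || (p == (b, a))) s.

Lemma edge_countC (T : eqType) (s : seq (T * T)) a b :
  edge_count s a b = edge_count s b a.
Proof.
rewrite /edge_count eq_sym; case: (b == a) => //.
by apply: eq_count => p; rewrite orbC.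
Qed.

Lemma edge_countxx (T : eqType) (s : seq (T * T)) a : edge_count s a a = 0.
Proof. by rewrite /edge_count eqxx. Qed.

Section SquaredCycle.
Import GRing.Theory.
Local Open Scope ring_scope.

(* For n >= 3, which is the only case of interest, 'Z_n is the ring of
   integers modulo n.  The list is a multiset: its entries are not all distinct
   modulo n when n is 3 or 4. *)
Definition sqcycle_mult (n : nat) (a b : 'Z_n) : nat :=
  if a == b then 0%N else count_mem (b - a) [:: 1; -1; 2%:R; - 2%:R].

Lemma sqcycle_multC (n : nat) (a b : 'Z_n) :
  sqcycle_mult a b = sqcycle_mult b a.
Proof.
rewrite /sqcycle_mult [b == a]eq_sym; case: (a == b) => //.
set c := b - a; have -> : a - b = - c by rewrite opprB.
have oppE (s : 'Z_n) : (s == - c) = (- s == c) by rewrite -eqr_oppLR.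
by rewrite /= !oppE !opprK addnCA; congr (_ + (_ + _))%N; rewrite addnCA.
Qed.

Lemma sqcycle_multxx (n : nat) (a : 'Z_n) : sqcycle_mult a a = 0%N.
Proof. by rewrite /sqcycle_mult eqxx. Qed.

Definition sqcycle (n : nat) : multigraph :=
  Multigraph (@sqcycle_multC n) (@sqcycle_multxx n).

End SquaredCycle.

(* An edge is a copy, numbered from 0 to mult x y - 1, of an unordered pair
   {x, y}; the latter is represented by the ordered pair whose first component
   comes first in the enumeration of the vertices. *)
Definition edge (G : multigraph) : finType :=
  {e : {p : G * G & 'I_(mult p.1 p.2)} |
     enum_rank (tag e).1 < enum_rank (tag e).2}.

Definition ends (G : multigraph) (e : edge G) : {set G} :=
  [set (tag (val e)).1; (tag (val e)).2].

Definition line_mult (M : multigraph) (e f : edge M) : nat :=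
  if e == f then 0 else #|ends e :&: ends f|.

Lemma line_multC (M : multigraph) (e f : edge M) :
  line_mult e f = line_mult f e.
Proof. by rewrite /line_mult eq_sym setIC. Qed.

Lemma line_multxx (M : multigraph) (e : edge M) : line_mult e e = 0.
Proof. by rewrite /line_mult eqxx. Qed.

Definition line_multigraph (M : multigraph) : multigraph :=
  Multigraph (@line_multC M) (@line_multxx M).

Definition F5_edges : seq (nat * nat) :=
  let: (x, y, u, v1, v2) := (0, 1, 2, 3, 4) in
  [:: (u, x); (u, y); (u, v1); (u, v2); (x, v1); (y, v2);
      (v1, v2); (v1, v2); (x, y); (x, y)].

Definition F5_mult (a b : 'I_5) : nat := edge_count F5_edges a b.

Lemma F5_multC (a b : 'I_5) : F5_mult a b = F5_mult b a.
Proof. exact: edge_countC. Qed.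

Lemma F5_multxx (a : 'I_5) : F5_mult a a = 0.
Proof. exact: edge_countxx. Qed.

Definition F5 : multigraph := Multigraph F5_multC F5_multxx.

Definition has_edges (G : multigraph) (s : seq (G * G)) : Prop :=
  forall a b : G, edge_count s a b <= mult a b.

Definition remove_mult (G : multigraph) (s : seq (G * G)) (a b : G) : nat :=
  mult a b - edge_count s a b.

Lemma remove_multC (G : multigraph) (s : seq (G * G)) (a b : G) :
  remove_mult s a b = remove_mult s b a.
Proof. by rewrite /remove_mult multC edge_countC. Qed.

Lemma remove_multxx (G : multigraph) (s : seq (G * G)) (a : G) :
  remove_mult s a a = 0.
Proof. by rewrite /remove_mult multxx. Qed.

Definition remove_edges (G : multigraph) (s : seq (G * G)) : multigraph :=
  Multigraph (remove_multC s) (remove_multxx s).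

Section Replace.
Variables (G : multigraph) (D : {set G}) (s : seq (G * G)) (k : nat).
Variable t : seq ((G + nat) * (G + nat)).

Definition replace_vert : finType := ({v : G | v \notin D} + 'I_k)%type.

Definition replace_label (a : replace_vert) : G + nat :=
  match a with inl v => inl (val v) | inr i => inr (val i) end.

Definition kept_mult (a b : replace_vert) : nat :=
  match a, b with
  | inl v, inl w => @mult (remove_edges s) (val v) (val w)
  | _, _ => 0
  end.

Definition replace_mult (a b : replace_vert) : nat :=
  kept_mult a b + edge_count t (replace_label a) (replace_label b).

Lemma replace_multC a b : replace_mult a b = replace_mult b a.
Proof.
rewrite /replace_mult edge_countC; congr (_ + _).
by case: a b => [v|i] [w|j] //; apply: multC.
Qed.

Lemma replace_multxx a : replace_mult a a = 0.
Proof.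
rewrite /replace_mult edge_countxx.
by case: a => [v|i] //=; rewrite remove_multxx.
Qed.

(* The edges in s and the vertices in D (with any edges still incident to them)
   are deleted, k new vertices are created and the edges in t are added.  In t,
   [inl v] is the remaining vertex v and [inr i] is the new vertex number i. *)
Definition replace : multigraph := Multigraph replace_multC replace_multxx.

End Replace.

Definition eligible (G : multigraph) (x y z : G) : Prop :=
  triangle x y z /\
  (triangle_property (remove_edges [:: (x, y); (y, z); (z, x)]) \/
   [\/ mult x y = 3, mult y z = 3 | mult z x = 3]).

(* In each operation below, an uncapitalized name is a vertex of G and the
   capitalized names are the vertices of the new multigraph. *)

Definition operation1 (G H : multigraph) : Prop :=
  exists x y z : G, eligible x y z /\
  let: (X, Y, Z) := (inl x, inl y, inl z) in
  let: (U, V, W) := (inr 0, inr 1, inr 2) in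
  isomorphic H (replace set0 [:: (x, y); (y, z); (z, x)] 3
    [:: (X, U); (U, Y); (Y, W); (W, Z); (Z, V); (V, X);
        (U, V); (V, W); (W, U)]).

Definition operation2 (G H : multigraph) : Prop :=
  exists x y z : G, eligible x y z /\
  let: (X, Y, Z) := (inl x, inl y, inl z) in
  let: (U, V) := (inr 0, inr 1) in
  isomorphic H (replace set0 [:: (x, y); (y, z); (z, x)] 2
    [:: (U, X); (U, Y); (U, Z); (V, X); (V, Y); (V, Z); (U, V)]).

(* In a quartic multigraph, every edge incident to a vertex deleted by one of
   the operations below belongs to the replaced subgraph: the listed edges
   already give that vertex degree 4. *)

Definition operation3 (G H : multigraph) : Prop :=
  exists x p q : G, uniq [:: x; p; q] /\
  let old := [:: (x, p); (x, q); (p, q); (p, q); (p, q)] in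
  let: (X, P, Q, R) := (inl x, inr 0, inr 1, inr 2) in
  has_edges old /\
  isomorphic H (replace [set p; q] old 3
    [:: (X, P); (X, Q); (P, Q); (P, R); (P, R); (Q, R); (Q, R)]).

Definition operation4 (G H : multigraph) : Prop :=
  exists x y u v : G, uniq [:: x; y; u; v] /\
  let old := [:: (x, u); (x, v); (y, u); (y, v); (u, v); (u, v)] in
  let: (X, Y, U, V1, V2) := (inl x, inl y, inr 0, inr 1, inr 2) in
  has_edges old /\
  isomorphic H (replace [set u; v] old 3
    [:: (U, X); (U, Y); (U, V1); (U, V2); (X, V1); (Y, V2);
        (V1, V2); (V1, V2)]).

Definition operation5 (G H : multigraph) : Prop :=
  exists x b c d e : G, uniq [:: x; b; c; d; e] /\
  let old := [:: (x, b); (x, c); (b, c); (b, d); (c, d); (b, e); (c, e);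
                 (d, e); (d, e)] in
  let: (X, P, Q) := (inl x, inr 0, inr 1) in
  has_edges old /\
  isomorphic H (replace [set b; c; d; e] old 2
    [:: (X, P); (X, Q); (P, Q); (P, Q); (P, Q)]).

Definition operation (G H : multigraph) : Prop :=
  [/\ regular 4 G, triangle_property G &
   [\/ operation1 G H, operation2 G H, operation3 G H | operation4 G H]
   \/ operation5 G H].

Inductive obtained_from (G0 : multigraph) : multigraph -> Prop :=
| obtained_iso G : isomorphic G0 G -> obtained_from G0 G
| obtained_step G H :
    obtained_from G0 G -> operation G H -> obtained_from G0 H.

(* Main.v *)
(** A quartic multigraph is a line multigraph of a cubic multigraph M iff its
    edges split into edge-disjoint triangles: the triangles are the vertices
    of M, and a vertex of the graph, lying in two triangles, is an edge of M.
    It is therefore enough to split the edges into edge-disjoint blocks, each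
    of which is a triangle or becomes a set of triangles when Operations 2-5
    are undone.  As every block has the triangle property by itself, so has
    the rest of the graph, which makes the triangle needed for Operation 2
    eligible.

    The blocks are removed one at a time, preserving the triangle property.
    Once some edge has been removed, connectedness provides a vertex of degree
    2, and there a block can always be removed.  Hence only the first block has
    to be found in the quartic graph itself.  If no block can be removed there,
    the graph is the squared 4-cycle, or F_5, or it is simple and has a vertex
    whose four neighbours induce exactly a path p0-p1-p3-p4.  In the last case
    the same holds at p3, with p1-p2-p4-p5, and so on; the sequence (p_i)
    closes up to a squared cycle. *)

Require Import Defs.
From mathcomp Require Import all_boot all_algebra zify ring.
From Stdlib Require Import Classical_Prop.

Set Implicit Arguments.
Unset Strict Implicit.
Unset Printing Implicit Defensive.

(** * Edge-disjoint unions of blocks *)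

(** Undoing Operation 5 replaces two vertices by four, so the induction that undoes the operations
    cannot run on the order of the graph. It runs on a weight: the number of operations still to be
    undone before only triangles are left. A [Fish] first becomes a [Tail] and only then three
    triangles, so it weighs 2. Every undoing changes the vertex type; the induction therefore ranges
    over lists of blocks on arbitrary finite types.

    Every block has even degree at every vertex. Hence all degrees that occur while blocks are being
    removed are 0, 2 or 4, and a vertex with three known edge ends has exactly one more. The local
    case analyses rest on this: in a neighbourhood, the last unknown neighbour is forced because its
    edge needs a triangle. *)

Lemma iso_sym (G H : multigraph) : isomorphic G H -> isomorphic H G.
Proof.
case=> f [g fK gK] fE; exists g; first by exists f.
by move=> x y; rewrite -fE !gK.
Qed.

Lemma iso_trans (G H K : multigraph) :
  isomorphic G H -> isomorphic H K -> isomorphic G K.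
Proof.
case=> f f_bij fE [g g_bij gE]; exists (g \o f); first exact: bij_comp.
by move=> x y; rewrite /= gE fE.
Qed.

(** Each operation describes its result only up to isomorphism, so the last step absorbs the given
    isomorphism. *)
Lemma obtained_from_iso (G0 G H : multigraph) :
  obtained_from G0 G -> isomorphic G H -> obtained_from G0 H.
Proof.
move=> G0G; case: G0G => [{}G isoG|K {}G G0K [K4 Ktri opKG]] GH.
  exact: obtained_iso (iso_trans isoG GH).
have HG := iso_sym GH.
apply: (obtained_step G0K); split=> //.
case: opKG => [[]|].
- by case=> x [y [z [el iK]]]; left; constructor 1; exists x, y, z; split=> //;
    apply: iso_trans iK.
- by case=> x [y [z [el iK]]]; left; constructor 2; exists x, y, z; split=> //;
    apply: iso_trans iK.
- by case=> x [p [q [u [h iK]]]]; left; constructor 3; exists x, p, q;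
    split=> //; split=> //; apply: iso_trans iK.
- by case=> x [y [u [v [un [h iK]]]]]; left; constructor 4; exists x, y, u, v;
    split=> //; split=> //; apply: iso_trans iK.
- by case=> x [b [c [d [e [un [h iK]]]]]]; right; exists x, b, c, d, e;
    split=> //; split=> //; apply: iso_trans iK.
Qed.

Ltac neq_facts H :=
  rewrite /= ?inE ?negb_or ?andbT -?andbA in H;
  repeat match type of H with
  | is_true (_ && _) => let N := fresh "N" in case/andP: H => N H
  end.

Ltac neq_simp :=
  rewrite ?xpair_eqE ?eqxx;
  repeat match goal with
  | H : is_true (?x != ?y) |- context [?x == ?y] => rewrite (negPf H)
  | H : is_true (?x != ?y) |- context [?y == ?x] => rewrite [y == x]eq_sym (negPf H)
  end.

Section EdgeLists.
Variable T : eqType.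
Implicit Types (s : seq (T * T)) (a b : T).

Definition endpoints s : seq T := flatten [seq [:: p.1; p.2] | p <- s].

Definition loopless s := all (fun p => p.1 != p.2) s.

Lemma edge_count_cat s1 s2 a b :
  edge_count (s1 ++ s2) a b = edge_count s1 a b + edge_count s2 a b.
Proof. by rewrite /edge_count; case: eqP => // _; rewrite count_cat. Qed.

Lemma edge_count_cons p s a b :
  edge_count (p :: s) a b = edge_count [:: p] a b + edge_count s a b.
Proof. by rewrite -edge_count_cat. Qed.

Lemma edge_count_gt0 s a b :
  (0 < edge_count s a b) = (a != b) && (((a, b) \in s) || ((b, a) \in s)).
Proof.
rewrite /edge_count; case: eqP => //= _; rewrite -has_count.
apply/hasP/orP => [[p ps /orP[/eqP<-|/eqP<-]]|[ps|ps]]; first by left.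
- by right.
- by exists (a, b); rewrite ?eqxx.
- by exists (b, a); rewrite ?eqxx ?orbT.
Qed.

Lemma endpoints_cat s1 s2 : endpoints (s1 ++ s2) = endpoints s1 ++ endpoints s2.
Proof. by rewrite /endpoints map_cat flatten_cat. Qed.

Lemma mem_endpoints s a b : (a, b) \in s -> (a \in endpoints s) * (b \in endpoints s).
Proof.
by move=> abs; split; apply/flatten_mapP; exists (a, b); rewrite ?inE ?eqxx ?orbT.
Qed.

Lemma edge_count_out s a b : a \notin endpoints s -> edge_count s a b = 0.
Proof.
move=> a_s; apply/eqP; rewrite -leqn0 leqNgt; apply: contra a_s.
rewrite edge_count_gt0 => /andP[_ /orP[]] /mem_endpoints []; auto.
Qed.

End EdgeLists.

Lemma endpoints_map (T U : eqType) (f : T -> U) (s : seq (T * T)) :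
  endpoints [seq (f p.1, f p.2) | p <- s] = map f (endpoints s).
Proof. by elim: s => //= p s; rewrite /endpoints /= => ->. Qed.

Lemma edge_count_map (T U : eqType) (P : pred T) (f : T -> U)
    (s : seq (T * T)) (a b : T) :
    {in P &, injective f} -> {subset endpoints s <= P} -> P a -> P b ->
  edge_count [seq (f p.1, f p.2) | p <- s] (f a) (f b) = edge_count s a b.
Proof.
move=> f_inj sP Pa Pb; rewrite /edge_count (inj_in_eq f_inj) //.
case: eqP => // _; rewrite count_map; apply: eq_in_count => -[c d] /mem_endpoints[].
by move=> /sP Pc /sP Pd /=; rewrite !xpair_eqE !(inj_in_eq f_inj).
Qed.

Section ListGraph.
Variable T : finType.
Implicit Types s : seq (T * T).

Definition list_graph s : multigraph :=
  Multigraph (edge_countC s) (edge_countxx s).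

Lemma degree_list_graph s (x : T) :
  loopless s -> @degree (list_graph s) x = count_mem x (endpoints s).
Proof.
rewrite /degree /=; elim: s => [|[c d] s IHs] /= => [_|/andP[cd /IHs <-]].
  by rewrite big1 // => y _; rewrite /edge_count if_same.
under eq_bigr => y _ do rewrite edge_count_cons.
rewrite big_split /= addnA; congr (_ + _).
rewrite /edge_count /=.
have -> : \sum_i (if x == i then 0 else ((c, d) == (x, i)) || ((c, d) == (i, x)) + 0)
     = \sum_i ((c == x) * (d == i) + (d == x) * (c == i)).
  apply: eq_bigr => i _; rewrite addn0 !xpair_eqE !mulnb.
  have [<-|xi] := eqVneq x i.
    suff E : (c == x) && (d == x) = false by rewrite E andbC E.
    by apply: contraNF cd => /andP[/eqP-> /eqP->].

  case: (c =P x) => [cx|_]; case: (d =P x) => [dx|_];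
    rewrite ?andbF ?andbT ?orbF ?addn0 //=.
  by move: cd; rewrite cx dx eqxx.
have S1 (z : T) : \sum_i nat_of_bool (z == i) = 1.
  by rewrite (bigD1 z) //= eqxx big1 // => i /negPf; rewrite eq_sym => ->.
by rewrite big_split /= -!big_distrr /= !S1 !muln1.
Qed.

Lemma adjacent_list_graph s (x y : T) :
  @adjacent (list_graph s) x y = (x != y) && (((x, y) \in s) || ((y, x) \in s)).
Proof. exact: edge_count_gt0. Qed.

End ListGraph.

(* Tri is a triangle, K113 and Fan are the subgraphs inserted by Operations 2
   and 4, Fish and Tail are the new and the old subgraph of Operation 3 (Tail is
   also the new subgraph of Operation 5). *)
Inductive block (T : Type) :=
| Tri of T & T & T
| K113 of T & T & T & T & T
| Fan of T & T & T & T & T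
| Fish of T & T & T & T
| Tail of T & T & T.

Section Blocks.
Variable T : eqType.
Implicit Types (b : block T) (bs : seq (block T)).

Definition block_verts b : seq T := match b with
| Tri x y z => [:: x; y; z]
| K113 u v x y z => [:: u; v; x; y; z]
| Fan x y u v1 v2 => [:: x; y; u; v1; v2]
| Fish x p q r => [:: x; p; q; r]
| Tail x p q => [:: x; p; q]
end.

Definition block_edges b : seq (T * T) := match b with
| Tri x y z => [:: (x, y); (y, z); (z, x)]
| K113 u v x y z => [:: (u, x); (u, y); (u, z); (v, x); (v, y); (v, z); (u, v)]
| Fan x y u v1 v2 =>
    [:: (u, x); (u, y); (u, v1); (u, v2); (x, v1); (y, v2); (v1, v2); (v1, v2)]
| Fish x p q r =>
    [:: (x, p); (x, q); (p, q); (p, r); (p, r); (q, r); (q, r)]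
| Tail x p q => [:: (x, p); (x, q); (p, q); (p, q); (p, q)]
end.

Definition block_wf b := uniq (block_verts b).

Definition edges_of bs : seq (T * T) := flatten (map block_edges bs).

Lemma edges_of_cat bs1 bs2 : edges_of (bs1 ++ bs2) = edges_of bs1 ++ edges_of bs2.
Proof. by rewrite /edges_of map_cat flatten_cat. Qed.

Lemma block_loopless b : block_wf b -> loopless (block_edges b).
Proof.
rewrite /block_wf; case: b => *; match goal with H : is_true _ |- _ => neq_facts H end;
  rewrite /loopless /=; by neq_simp.
Qed.

Lemma edges_of_loopless bs : all block_wf bs -> loopless (edges_of bs).
Proof.
elim: bs => //= b bs IHbs /andP[wf_b /IHbs loops].
by rewrite /edges_of /= /loopless all_cat (block_loopless wf_b : all _ _).
Qed.

Lemma block_triangle b x y : block_wf b -> (x, y) \in block_edges b ->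
  exists2 z, (x, z) \in block_edges b \/ (z, x) \in block_edges b
           & (y, z) \in block_edges b \/ (z, y) \in block_edges b.
Proof.
case: b => [a b c|u v a b c|a b u v1 v2|a p q r|a p q] _; rewrite !inE !xpair_eqE.
all: repeat case/orP; case/andP => /eqP-> /eqP->.
all: match goal with z : _ |- _ =>
  solve [exists z; rewrite !inE !xpair_eqE !eqxx ?orbT; auto] end.
Qed.
End Blocks.
Arguments block_wf {T} b.
Arguments block_verts {T} b.
Arguments block_edges {T} b.

(** Blocks carry no decidable equality here, hence [List.In] for membership of a block. *)
Lemma mem_edges_of (T : eqType) (bs : seq (block T)) (p : T * T) :
  reflect (exists2 b, List.In b bs & p \in block_edges b) (p \in edges_of bs).
Proof.
elim: bs => [|b bs IHbs] /=; first by constructor=> -[].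
rewrite /edges_of /= mem_cat; apply: (iffP orP) => [[pb|/IHbs[b' b'_bs pb']]|].
- by exists b; auto.
- by exists b'; auto.
- by case=> b' [<-|b'_bs] pb'; [left|right; apply/IHbs; exists b'].
Qed.

Lemma block_graph_triangles (T : finType) (bs : seq (block T)) :
  all block_wf bs -> triangle_property (list_graph (edges_of bs)).
Proof.
move=> wf_bs x y; rewrite adjacent_list_graph => /andP[xy /orP xy_bs].
have loops := edges_of_loopless wf_bs.
suff [z xz yz] : exists2 z, ((x, z) \in edges_of bs) || ((z, x) \in edges_of bs)
    & ((y, z) \in edges_of bs) || ((z, y) \in edges_of bs).
  have neq a b : ((a, b) \in edges_of bs) || ((b, a) \in edges_of bs) -> a != b.
    by case/orP => /(allP loops) //=; rewrite eq_sym.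
  exists z; split; rewrite adjacent_list_graph ?xy ?(introT orP xy_bs) //.
    by rewrite yz andbT neq.
  by rewrite orbC xz andbT eq_sym neq.
have inE b a c : List.In b bs -> (a, c) \in block_edges b \/ (c, a) \in block_edges b ->
    ((a, c) \in edges_of bs) || ((c, a) \in edges_of bs).
  by move=> b_bs [] ac; apply/orP; [left|right]; apply/mem_edges_of; exists b.
case: xy_bs => /mem_edges_of[b b_bs] /block_triangle => E.
- have [|z xz yz] := E.
    by elim: (bs) wf_bs b_bs => //= b' bs' IH /andP[? ?] [<-|]; auto.
  by exists z; apply: inE b_bs _.
- have [|z xz yz] := E.
    by elim: (bs) wf_bs b_bs => //= b' bs' IH /andP[? ?] [<-|]; auto.
  by exists z; apply: inE b_bs _.
Qed.

Definition block_map (T U : Type) (f : T -> U) (b : block T) : block U :=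
  match b with
  | Tri x y z => Tri (f x) (f y) (f z)
  | K113 u v x y z => K113 (f u) (f v) (f x) (f y) (f z)
  | Fan x y u v1 v2 => Fan (f x) (f y) (f u) (f v1) (f v2)
  | Fish x p q r => Fish (f x) (f p) (f q) (f r)
  | Tail x p q => Tail (f x) (f p) (f q)
  end.

Lemma block_verts_map (T U : eqType) (f : T -> U) (b : block T) :
  block_verts (block_map f b) = map f (block_verts b).
Proof. by case: b. Qed.

Lemma edges_of_map (T U : eqType) (f : T -> U) (bs : seq (block T)) :
  edges_of (map (block_map f) bs) = [seq (f p.1, f p.2) | p <- edges_of bs].
Proof.
elim: bs => //= b bs IHbs; rewrite /edges_of /= map_cat -/(edges_of _) IHbs.
by congr (_ ++ _); case: b.
Qed.

Lemma block_verts_endpoints (T : eqType) (b : block T) :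
  {subset block_verts b <= endpoints (block_edges b)}.
Proof.
by case: b => *; move=> w; rewrite /= !inE;
  repeat case/orP; move=> /eqP->; rewrite eqxx ?orbT.
Qed.

(* The vertices in N, which have degree 4 in the block b0, are deleted together
   with b0, and m new vertices and the blocks obs are added. *)
Section Surgery.
Variables (T : finType) (N : seq T) (m : nat) (x0 : {t : T | t \notin N}).

Definition surgery_type : finType := ({t : T | t \notin N} + 'I_m)%type.

(** Vertices of [N] are sent to the default [x0]; this does no harm, since [embed] is only relied on
    for vertices outside [N], where it is injective. *)
Definition embed (t : T) : surgery_type := inl (insubd x0 t).

(** These are the labels that [replace] expects: a vertex of [N] is a vertex to be created, numbered
    by its position in [N]. The order of [N] must therefore match the numbering in the operation. *)
Definition surgery_label (t : T) : surgery_type + nat :=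
  if t \in N then inr (index t N) else inl (embed t).

Lemma embed_inj : {in [predC N] &, injective embed}.
Proof.
by move=> a b aN bN [] /(congr1 val); rewrite /insubd !insubT.
Qed.

Lemma surgery_label_inj : injective surgery_label.
Proof.
move=> a b; rewrite /surgery_label.
case: ifPn => aN; case: ifPn => bN //.
  by case=> ab; rewrite -(nth_index (val x0) aN) ab nth_index.
by case=> ab; apply: embed_inj => //; rewrite /embed ab.
Qed.

Variables (b0 : block T) (bs : seq (block T)) (obs : seq (block surgery_type)).
Let new := block_edges b0.
Let H := list_graph (edges_of (b0 :: bs)).
Let bs' := obs ++ map (block_map embed) bs.
Let G := list_graph (edges_of bs').

Hypothesis N_uniq : uniq N.
Hypothesis H_reg : regular 4 H.
Hypothesis H_wf : all block_wf (b0 :: bs).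
Hypothesis obs_wf : all block_wf obs.
Hypothesis N_new : {in N, forall n, count_mem n (endpoints new) = 4}.
Hypothesis obs_old : forall t, t \notin N ->
  count_mem (embed t) (endpoints (edges_of obs)) = count_mem t (endpoints new).
Hypothesis obs_ord : forall i : 'I_m,
  count_mem (inr i : surgery_type) (endpoints (edges_of obs)) = 4.

Let H_deg t : count_mem t (endpoints new) + count_mem t (endpoints (edges_of bs)) = 4.
Proof.
have := H_reg t; rewrite degree_list_graph; last exact: edges_of_loopless.
by rewrite /edges_of /= endpoints_cat count_cat.
Qed.

(** The block [b0] already uses up the degree 4 of the vertices in [N]. *)
Let rest_out : {subset endpoints (edges_of bs) <= [predC N]}.
Proof.
move=> t t_bs; apply/negP => tN; have := H_deg t; rewrite N_new //.
by rewrite -[RHS]addn0 => /addnI /eqP; rewrite eqn0Ngt -has_count has_pred1 t_bs.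
Qed.

Lemma surgery_wf : all block_wf bs'.
Proof.
rewrite all_cat obs_wf /= all_map; case/andP: H_wf => _ bs_wf.
elim: bs bs_wf rest_out => //= b bs1 IHbs /andP[b_wf bs1_wf] out.
rewrite IHbs ?andbT // => [|t t_bs1]; last first.
  by apply: out; rewrite /edges_of /= endpoints_cat mem_cat t_bs1 orbT.
rewrite /block_wf block_verts_map map_inj_in_uniq // => s t sb tb.
by apply: embed_inj; apply: out; rewrite /edges_of /= endpoints_cat mem_cat
  block_verts_endpoints.
Qed.

Lemma surgery_regular : regular 4 G.
Proof.
move=> w; rewrite degree_list_graph; last exact: edges_of_loopless surgery_wf.
rewrite edges_of_cat endpoints_cat count_cat edges_of_map endpoints_map.
case: w => [[t tN]|i].
  have -> : inl (exist _ t tN) = embed t by congr inl; apply: val_inj;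
    rewrite val_insubd tN.
  rewrite obs_old // -(H_deg t); congr (_ + _); rewrite count_map.
  apply: eq_in_count => s /rest_out sN /=.
  by rewrite (inj_in_eq embed_inj).
rewrite obs_ord count_map (eq_count (a2 := pred0)) ?count_pred0 //.
Qed.

(** This certifies that the operation applied to [G] gives back [H]: deleting the [m] auxiliary
    vertices and the edges of [obs] leaves the embedded copy of [bs], and the relabelled edges of
    [b0] restore the block. *)
Lemma surgery_replace (D : {set surgery_type})
  (old : seq (surgery_type * surgery_type)) s :
    (forall w, (w \in D) = (if w is inl _ then false else true)) ->
    edge_count old =2 edge_count (edges_of obs) ->
    s = [seq (surgery_label p.1, surgery_label p.2) | p <- new] ->
  isomorphic H (@replace G D old (size N) s).
Proof.
move=> DE oldE sE.
have embD t : embed t \notin D by rewrite DE.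
pose f (t : T) : @replace_vert G D (size N) :=
  if insub (index t N) is Some i then inr i else inl (exist _ (embed t) (embD t)).
pose g (w : @replace_vert G D (size N)) : T := match w with
  | inr i => nth (val x0) N i
  | inl w => if val w is inl t then val t else val x0 end.
have fN t : t \in N -> exists2 i, f t = inr i & val i = index t N.
  move=> tN; rewrite /f; case: insubP => [i _ <-|]; first by exists i.
  by rewrite index_mem tN.
have fC t : t \notin N -> f t = inl (exist _ (embed t) (embD t)).
  by move=> tN; rewrite /f; case: insubP => // i; rewrite index_mem (negPf tN).
have labE t : replace_label (f t) = surgery_label t.
  rewrite /surgery_label; case: ifPn => [/fN[i -> iE]|/fC->] //.
  by rewrite /= iE.
exists f.
  exists g => [t|[[w /= wD]|i]].
  - have [tN|tN] := boolP (t \in N).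
      by have [i -> /= ->] := fN t tN; rewrite nth_index.
    by rewrite fC //= /embed /= val_insubd tN.
  - have := wD; rewrite DE; case: w wD => //= -[t tN] wD _.
    rewrite fC //; congr inl; apply: val_inj; rewrite /=.
    by congr inl; apply: val_inj; rewrite val_insubd tN.
  - have [|j -> jE] := fN (nth (val x0) N i); first exact: mem_nth.
    by congr inr; apply: val_inj; rewrite /= jE index_uniq.
move=> a b; rewrite /= /replace_mult !labE sE (edge_count_map (P := predT)) //;
  last first.
  by move=> ? ? _ _; apply: surgery_label_inj.
rewrite /edges_of /= edge_count_cat addnC; congr (_ + _).
have [aN|aN] := boolP (a \in N).
  have [i -> _] := fN a aN; rewrite edge_count_out //.
  by apply/negP => /rest_out; rewrite inE aN.
have [bN|bN] := boolP (b \in N).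
  have [i -> _] := fN b bN; rewrite edge_countC edge_count_out.
    by case: (f a).
  by apply/negP => /rest_out; rewrite inE bN.
rewrite !fC //= /remove_mult /= oldE edges_of_cat edge_count_cat addKn.
by rewrite edges_of_map (edge_count_map embed_inj).
Qed.

End Surgery.

(** * Line multigraphs *)

Section TriangleCover.
Variables (G : multigraph) (I : finType) (A : I -> {set G}) (t0 : G).

(** The root graph of the line multigraph: its vertices are the triangles, and each vertex shared by
    two triangles gives one edge between them. Two triangles may share several vertices, whence
    parallel edges. *)
Definition cover_mult (i j : I) : nat := if i == j then 0 else #|A i :&: A j|.

Lemma cover_multC i j : cover_mult i j = cover_mult j i.
Proof. by rewrite /cover_mult eq_sym setIC. Qed.

Lemma cover_multxx i : cover_mult i i = 0.
Proof. by rewrite /cover_mult eqxx. Qed.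

Definition cover_graph : multigraph := Multigraph cover_multC cover_multxx.

Hypothesis A_card : forall i, #|A i| = 3.
Hypothesis A_degree : forall t, #|[set i | t \in A i]| = 2.
Hypothesis A_mult : forall a b, a != b ->
  mult a b = #|[set i | (a \in A i) && (b \in A i)]|.

(** Double counting: each of the three elements of [A i] lies in exactly one other set, by
    [A_degree]. *)
Lemma cover_graph_cubic : regular 3 cover_graph.
Proof.
move=> i; rewrite /degree /= (bigD1 i) //= cover_multxx add0n.
transitivity (\sum_(j | j != i) \sum_(t in A i) (t \in A j : nat)).
  apply: eq_bigr => j; rewrite /cover_mult eq_sym => /negPf ->.
  rewrite -sum1_card big_mkcond [RHS]big_mkcond /=.
  by apply: eq_bigr => t _; rewrite inE; case: (t \in A i); case: (t \in A j).
rewrite exchange_big /= -[RHS](A_card i) -sum1_card; apply: eq_bigr => t tAi.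
apply/eqP; rewrite -(eqn_add2l 1) -[_ + 1]/2 -[X in _ == X](A_degree t).
rewrite -sum1_card [X in _ == X](bigD1 i) ?inE //= eqn_add2l.
rewrite [X in X == _]big_mkcond [X in _ == X]big_mkcond; apply/eqP.
by apply: eq_bigr => j _; rewrite inE andbC; case: (j != i); case: (t \in A j).
Qed.

(** The copy number of an edge between [i] and [j] selects an element of the intersection of [A i]
    and [A j]. *)
Definition cover_vertex (e : edge cover_graph) : G :=
  nth t0 (enum (A (tag (val e)).1 :&: A (tag (val e)).2)) (tagged (val e)).

Lemma cover_vertexP (e : edge cover_graph) :
  [/\ tagged (val e) < #|A (tag (val e)).1 :&: A (tag (val e)).2|,
      cover_vertex e \in A (tag (val e)).1,
      cover_vertex e \in A (tag (val e)).2
    & (tag (val e)).1 != (tag (val e)).2].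
Proof.
rewrite /cover_vertex; case: e => -[[i j] /= k] ij; rewrite /=.
have ij' : i != j by apply: contraTneq ij => ->; rewrite ltnn.
have lt_k : k < #|A i :&: A j|.
  by apply: leq_trans (ltn_ord k) _; rewrite /= /cover_mult (negPf ij').
have: nth t0 (enum (A i :&: A j)) k \in A i :&: A j.
  by rewrite -mem_enum mem_nth // -cardE.
by rewrite inE => /andP[? ?]; split.
Qed.

Lemma cover_vertex_ends (e : edge cover_graph) : ends e = [set i | cover_vertex e
  \in A i].
Proof.
have [_ Ai Aj ij] := cover_vertexP e; apply/eqP.
rewrite eqEcard A_degree cards2 ij andbT; apply/subsetP => i.
by rewrite !inE => /orP[] /eqP->.
Qed.

(** Equal images have equal ends. The ordering by [enum_rank] built into [edge] excludes the swapped
    pair, and within one intersection the enumeration has no repetition. *)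
Lemma cover_vertex_inj : injective cover_vertex.
Proof.
move=> e f ef; have efE : ends e = ends f by rewrite !cover_vertex_ends ef.
have [lt_e _ _ _] := cover_vertexP e; have [lt_f _ _ _] := cover_vertexP f.
apply: val_inj; move: ef efE lt_e lt_f; rewrite /cover_vertex /ends.
case: e => -[[i j] /= k] ij; case: f => -[[i' j'] /= k'] ij' /= ef efE lt_e lt_f.
have iS : i \in [set i'; j'] by rewrite -efE !inE eqxx.
have jS : j \in [set i'; j'] by rewrite -efE !inE eqxx orbT.
move: iS jS; rewrite !inE => /orP[]/eqP ii' /orP[]/eqP jj'; subst i j; try lia.
congr existT; apply: val_inj; apply/eqP.
by rewrite -(nth_uniq t0 (s := enum (A i' :&: A j'))) ?enum_uniq -?cardE // ef.
Qed.

Lemma cover_vertex_surj t : exists e, cover_vertex e = t.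
Proof.
have /cards2P[i [j [ij tE]]] : #|[set i | t \in A i]| == 2 by rewrite A_degree.
have [ti tj] : t \in A i /\ t \in A j.
  by split; [have := set21 i j|have := set22 i j]; rewrite -tE inE.
wlog lt_ij : i j ij {tE} ti tj / enum_rank i < enum_rank j.
  move=> IH; case: (ltngtP (enum_rank i) (enum_rank j)) => [||/val_inj/enum_rank_inj E].
  - exact: IH.
  - by apply: IH; rewrite 1?eq_sym.
  - by rewrite E eqxx in ij.
have lt_t : index t (enum (A i :&: A j)) < @mult cover_graph (i, j).1 (i, j).2.
  by rewrite /= /cover_mult (negPf ij) cardE index_mem mem_enum inE ti.
exists (exist _ (existT _ (i, j) (Ordinal lt_t)) lt_ij).
by rewrite /cover_vertex /= nth_index // mem_enum inE ti.
Qed.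

(** The ends of the edge representing [a] are the two sets containing [a], so two edges share as
    many ends as there are sets containing both elements, which is the multiplicity by [A_mult]. *)
Lemma cover_graph_line : isomorphic G (line_multigraph cover_graph).
Proof.
apply: iso_sym; exists cover_vertex.
  apply: inj_card_bij; first exact: cover_vertex_inj.
  rewrite -(card_codom cover_vertex_inj); apply/subset_leq_card/subsetP => t _.
  by have [e <-] := cover_vertex_surj t; apply: codom_f.
move=> e f; rewrite /= /line_mult; have [->|ef] := eqVneq e f; first exact: multxx.
rewrite A_mult ?(inj_eq cover_vertex_inj) //; apply: eq_card => i.
by rewrite !cover_vertex_ends !inE.
Qed.

End TriangleCover.

Lemma edge_count_edges_of (T : eqType) (bs : seq (block T)) (a b : T) :
  edge_count (edges_of bs) a b = \sum_(c <- bs) edge_count (block_edges c) a b.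
Proof.
elim: bs => [|c bs IHbs]; first by rewrite big_nil /edge_count if_same.
by rewrite big_cons -IHbs /edges_of /= edge_count_cat.
Qed.

Lemma list_graph_iso (T : finType) (s1 s2 : seq (T * T)) :
  edge_count s1 =2 edge_count s2 -> isomorphic (list_graph s1) (list_graph s2).
Proof. by move=> s12; exists id; [exists id | move=> x y; rewrite /= s12]. Qed.

Lemma list_graph_regular (T : finType) k (s1 s2 : seq (T * T)) :
    edge_count s1 =2 edge_count s2 ->
  regular k (list_graph s1) -> regular k (list_graph s2).
Proof.
by move=> s12 reg x; rewrite -(reg x); apply: eq_bigr => y _; rewrite /= s12.
Qed.

Lemma has_split (T : Type) (p : pred T) s :
  has p s -> exists s1 x s2, s = s1 ++ x :: s2 /\ p x.
Proof.
elim: s => //= x s IHs; case: (boolP (p x)) => [px _|_ /IHs[s1 [y [s2 [-> py]]]]].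
  by exists [::], x, s.
by exists (x :: s1), y, s2.
Qed.

(** The number of undoing steps: [K113], [Fan] and [Tail] turn into triangles at once, a [Fish]
    turns into a [Tail] first. *)
Definition total_weight (T : Type) (bs : seq (block T)) :=
  \sum_(b <- bs) match b with
  | Tri _ _ _ => 0 | Fish _ _ _ _ => 2 | _ => 1 end.

Lemma total_weight_map (T U : Type) (f : T -> U) bs :
  total_weight (map (block_map f) bs) = total_weight bs.
Proof. by rewrite /total_weight big_map; apply: eq_bigr => -[]. Qed.

Definition is_tri T (b : block T) := if b is Tri _ _ _ then true else false.

Section AllTri.
Variables (T : finType) (t0 : T) (bs : seq (block T)).
Hypothesis bs_wf : all block_wf bs.
Hypothesis bs_tri : all (@is_tri T) bs.
Hypothesis bs_reg : regular 4 (list_graph (edges_of bs)).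

Let b i := nth (Tri t0 t0 t0) bs i.

Let bP (i : 'I_(size bs)) : exists x y z, b i = Tri x y z /\ uniq [:: x; y; z].
Proof.
have := all_nthP (Tri t0 t0 t0) bs_wf i (ltn_ord i).
have := all_nthP (Tri t0 t0 t0) bs_tri i (ltn_ord i).
by rewrite -/(b i); case: (b i) => // x y z _; exists x, y, z.
Qed.

(** A triangle through [t] contributes 2 to its degree 4, so every vertex lies in exactly two
    triangles and the triangle cover applies. *)
Lemma triangles_obtained :
  exists M, regular 3 M /\ obtained_from (line_multigraph M) (list_graph (edges_of bs)).
Proof.
pose A (i : 'I_(size bs)) : {set list_graph (edges_of bs)} :=
  [set t in block_verts (b i)].
have A_card i : #|A i| = 3.
  have [x [y [z [bE xyz]]]] := bP i.
  by rewrite /A bE cardsE; apply: (card_uniqP xyz).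
have A_degree t : #|[set i | t \in A i]| = 2.
  have := bs_reg t; rewrite degree_list_graph; last exact: edges_of_loopless.
  have -> : count_mem t (endpoints (edges_of bs)) = \sum_(c <- bs) count_mem t
    (endpoints (block_edges c)).
    elim: (bs) => [|c cs IH]; first by rewrite big_nil.
    by rewrite big_cons -IH /edges_of /= endpoints_cat count_cat.
  rewrite (big_nth (Tri t0 t0 t0)) big_mkord.
  have E (i : 'I_(size bs)) : count_mem t (endpoints (block_edges (b i))) = 2 * (t
    \in A i).
    have [x [y [z [bE xyz]]]] := bP i; rewrite /A inE bE; neq_facts xyz.
    rewrite /= !inE ![_ == t]eq_sym.
    have [->|tx] := eqVneq t x; neq_simp => //.
    have [->|ty] := eqVneq t y; neq_simp => //.
  under eq_bigr => i _ do rewrite -/(b i) E.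
  rewrite -big_distrr /= => S4.
  have -> : #|[set i | t \in A i]| = \sum_i (t \in A i : nat).
    by rewrite -sum1_card big_mkcond; apply: eq_bigr => i _; rewrite inE;
        case: (t \in A i).
  by apply/eqP; rewrite -(eqn_pmul2l (m := 2)) //; apply/eqP.
have A_mult x y : x != y ->
    @mult (list_graph (edges_of bs)) x y = #|[set i | (x \in A i) && (y \in A i)]|.
  move=> xy; rewrite /= edge_count_edges_of (big_nth (Tri t0 t0 t0)) big_mkord.
  rewrite -sum1_card [RHS]big_mkcond /=; apply: eq_bigr => i _.
  rewrite -/(b i); have [x' [y' [z' [bE xyz]]]] := bP i.
  rewrite /A !inE bE /edge_count (negPf xy) /= !inE !xpair_eqE; neq_facts xyz.
  rewrite ![_ == x]eq_sym ![_ == y]eq_sym.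
  move: xy; clear bE.
  have [->|?] := eqVneq x x'; last (have [->|?] := eqVneq x y';
    last have [->|?] := eqVneq x z');
  (have [E|?] := eqVneq y x'; [|have [E|?] := eqVneq y y';
    [|have [E|?] := eqVneq y z']]);
  rewrite ?E; by neq_simp.
exists (cover_graph A); split; first exact: cover_graph_cubic.
by apply: obtained_iso; apply: iso_sym; apply: cover_graph_line.
Qed.
End AllTri.

Section EmbedEq.
Variables (T : finType) (N : seq T) (m : nat) (x0 : {t : T | t \notin N}).

Lemma embed_eq s t : s \notin N -> t \notin N ->
  (embed m x0 s == embed m x0 t) = (s == t).
Proof. by move=> sN tN; apply: (inj_in_eq (@embed_inj T N m x0)). Qed.

End EmbedEq.

Definition obtained_blocks (T : finType) (bs : seq (block T)) : Prop :=
  exists M, regular 3 M /\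
    obtained_from (line_multigraph M) (list_graph (edges_of bs)).

Lemma has_edges_of (T : finType) (obs bs : seq (block T)) old :
    edge_count old =2 edge_count (edges_of obs) ->
  has_edges (G := list_graph (edges_of (obs ++ bs))) old.
Proof.
by move=> E a b; rewrite E [X in _ <= X]/= edges_of_cat edge_count_cat leq_addr.
Qed.

(** * Undoing the operations *)

Section Reductions.
Variables (T : finType) (bs : seq (block T)).

(** The induction hypothesis quantifies over [U] because the undone graph lives on a surgery type.
    The element [u0] serves as a default where an edge of the root graph is turned into a vertex. *)
Definition obtained_below (n : nat) := forall (U : finType) (u0 : U)
  (cs : seq (block U)),
  total_weight cs < n -> all block_wf cs -> regular 4 (list_graph (edges_of cs)) ->
  obtained_blocks cs.

(** Common frame of the four reductions. The graph before the operation is quartic because [obs]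
    gives the old vertices the degrees they had in [b] and the auxiliary ones degree 4; it has the
    triangle property because it is a union of blocks. *)
Lemma reduce_block (nw : seq T) (m : nat) (x0 : {t | t \notin nw}) b obs :
    let e := embed m x0 in
    let G := list_graph (edges_of (obs ++ map (block_map e) bs)) in
    let H := list_graph (edges_of (b :: bs)) in
    obtained_below (total_weight (b :: bs)) ->
    total_weight obs < total_weight [:: b] ->
    all block_wf (b :: bs) -> regular 4 H -> all block_wf obs ->
    {in nw, forall n, count_mem n (endpoints (block_edges b)) = 4} ->
    (forall t, t \notin nw -> count_mem (e t) (endpoints (edges_of obs)) =
                              count_mem t (endpoints (block_edges b))) ->
    (forall i : 'I_m, count_mem (inr i : surgery_type nw m)
      (endpoints (edges_of obs)) = 4) ->
    [\/ operation1 G H, operation2 G H,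
      operation3 G H | operation4 G H] \/ operation5 G H ->
  obtained_blocks (b :: bs).
Proof.
move=> e G H IH lt_w wf_bs reg_bs wf_obs nw_b obs_old obs_ord ops.
have wf' := surgery_wf x0 reg_bs wf_bs wf_obs nw_b.
have reg' := surgery_regular reg_bs wf_bs wf_obs nw_b obs_old obs_ord.
have [|M [M_reg M_obt]] := IH _ (e (val x0)) _ _ wf' reg'.
  rewrite /total_weight big_cat /= -/(total_weight _) -/(total_weight (map _ _)).
  rewrite total_weight_map /total_weight big_cons ltn_add2r.
  by move: lt_w; rewrite /total_weight big_seq1.
exists M; split=> //; apply: (obtained_step M_obt).
by split=> //; apply: block_graph_triangles.
Qed.

Lemma edge_count_swap (U : eqType) (a b : U) s :
  edge_count ((a, b) :: s) =2 edge_count ((b, a) :: s).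
Proof.
move=> c d; rewrite /edge_count; case: eqP => //= _; rewrite !xpair_eqE.
by rewrite orbC [(b == c) && _]andbC [(b == d) && _]andbC.
Qed.

Ltac label_eq := rewrite /= /surgery_label !inE; neq_simp; rewrite /= ?eqxx; neq_simp.

Lemma reduce_K113 u v x y z :
    let b := K113 u v x y z in
    obtained_below (total_weight (b :: bs)) ->
    all block_wf (b :: bs) -> regular 4 (list_graph (edges_of (b :: bs))) ->
  obtained_blocks (b :: bs).
Proof.
move=> b IH wf_bs reg_bs; have := wf_bs => /= /andP[wf_b wf_r].
rewrite /block_wf in wf_b; neq_facts wf_b.
pose nw := [:: u; v].
have xN : x \notin nw by rewrite !inE; neq_simp.
have yN : y \notin nw by rewrite !inE; neq_simp.
have zN : z \notin nw by rewrite !inE; neq_simp.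
pose x0 : {t : T | t \notin nw} := exist _ x xN.
pose e := embed 0 x0.
pose obs := [:: Tri (e x) (e y) (e z)].
have nw_uniq : uniq nw by rewrite /= !inE; neq_simp.
have wf_obs : all block_wf obs by rewrite /= /block_wf /= !inE /e !embed_eq //;
  neq_simp.
have nw_b : {in nw, forall n, count_mem n (endpoints (block_edges b)) = 4}.
  by move=> n; rewrite !inE => /orP[]/eqP->; rewrite /= ; neq_simp.
have wf' := surgery_wf x0 reg_bs wf_bs wf_obs nw_b.
apply: (reduce_block (x0 := x0) (obs := obs)) => //.
- by rewrite /total_weight !big_seq1.
- move=> t tN; rewrite /= !embed_eq //; move: tN; rewrite !inE negb_or => /andP[tu tv].
  by neq_simp; do ?case: (_ == _).
- by case.
left; constructor 2; exists (e x), (e y), (e z); split.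
  split.
    by split; rewrite adjacent_list_graph /e embed_eq // ?inE ?eqxx ?orbT ?andbT;
        neq_simp.
  left.
  have wf_r' : all block_wf (map (block_map e) bs).
    by move: wf'; rewrite all_cat => /andP[].
  have E a c : @mult (list_graph (edges_of (map (block_map e) bs))) a c =
     @remove_mult (list_graph (edges_of (obs ++ map (block_map e) bs)))
       [:: (e x, e y); (e y, e z); (e z, e x)] a c.
    change (edge_count (edges_of (map (block_map e) bs)) a c =
      edge_count (edges_of (obs ++ map (block_map e) bs)) a c - edge_count
        (edges_of obs) a c).
    by rewrite edges_of_cat edge_count_cat addKn.
  move=> a c; rewrite /adjacent /= -E => /(block_graph_triangles wf_r')[d [ac cd da]].
  by exists d; split; rewrite /adjacent /= -E.
have iso := surgery_replace (s :=
  [seq (surgery_label 0 x0 p.1, surgery_label 0 x0 p.2) | p <- block_edges b])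
    (obs := obs) (D := set0) (old := block_edges (Tri (e x) (e y) (e z)))
  nw_uniq reg_bs wf_bs nw_b.
have -> : [:: (inr 0, inl (e x)); (inr 0, inl (e y)); (inr 0, inl (e z));
    (inr 1, inl (e x)); (inr 1, inl (e y)); (inr 1, inl (e z)); (inr 0, inr 1)] =
  [seq (surgery_label 0 x0 p.1, surgery_label 0 x0 p.2) | p <- block_edges b].
  by label_eq.
apply: iso => //.
  by move=> [w|[]//]; rewrite inE.
Qed.

(** The subgraph replaced by Operation 4 is two triangles on the double edge [uv]. The lists differ
    only in order and in the orientation of pairs. *)
Lemma fan_edges (U : eqType) (x y u v : U) :
  edge_count [:: (x, u); (x, v); (y, u); (y, v); (u, v); (u, v)] =2
  edge_count (edges_of [:: Tri x u v; Tri y u v]).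
Proof.
move=> a b; rewrite /edges_of /=.
rewrite !(edge_count_cons _ (_ :: _)) (edge_count_swap v x) (edge_count_swap v y); lia.
Qed.

(** The subgraph replaced by Operation 5 splits into three edge-disjoint triangles, two of them on
    the double edge [de]. *)
Lemma tail_edges (U : eqType) (x b c d e : U) :
  edge_count [:: (x, b); (x, c); (b, c); (b, d); (c, d); (b, e); (c, e); (d, e);
    (d, e)] =2
  edge_count (edges_of [:: Tri x b c; Tri b d e; Tri c d e]).
Proof.
move=> s t; rewrite /edges_of /=.
rewrite !(edge_count_cons _ (_ :: _)) (edge_count_swap c x) (edge_count_swap e b)
  (edge_count_swap e c); lia.
Qed.

Lemma reduce_Fan x y u v1 v2 :
    let b := Fan x y u v1 v2 in
    obtained_below (total_weight (b :: bs)) ->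
    all block_wf (b :: bs) -> regular 4 (list_graph (edges_of (b :: bs))) ->
  obtained_blocks (b :: bs).
Proof.
move=> b IH wf_bs reg_bs; have := wf_bs => /= /andP[wf_b wf_r].
rewrite /block_wf in wf_b; neq_facts wf_b.
pose nw := [:: u; v1; v2].
have xN : x \notin nw by rewrite !inE; neq_simp.
have yN : y \notin nw by rewrite !inE; neq_simp.
pose x0 : {t : T | t \notin nw} := exist _ x xN.
pose e := embed 2 x0.
pose p : surgery_type nw 2 := inr ord0.
pose q : surgery_type nw 2 := inr (@Ordinal 2 1 isT).
pose obs := [:: Tri (e x) p q; Tri (e y) p q].
have nw_uniq : uniq nw by rewrite /= !inE; neq_simp.
have nw_b : {in nw, forall n, count_mem n (endpoints (block_edges b)) = 4}.
  by move=> n; rewrite !inE => /or3P[]/eqP->; rewrite /= ; neq_simp.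
apply: (reduce_block (x0 := x0) (obs := obs)) => //.
- by rewrite /total_weight !big_cons !big_nil.
- move=> t tN; rewrite /= !embed_eq //; move: tN;
    rewrite !inE !negb_or => /and3P[tu tv tw].
  by neq_simp; do ?case: (_ == _).
- by case=> -[|[|]].
left; constructor 4; exists (e x), (e y), p, q; split.
  by rewrite /= !inE /e !embed_eq //; neq_simp.
split; first exact: (has_edges_of (obs := obs)) (@fan_edges _ _ _ _ _).
have iso := surgery_replace (s :=
  [seq (surgery_label 2 x0 p.1, surgery_label 2 x0 p.2) | p <- block_edges b])
    (obs := obs) (D := [set p;
      q]) nw_uniq reg_bs wf_bs nw_b _ (@fan_edges _ _ _ _ _) (erefl _).
have E : [:: (inr 0, inl (e x)); (inr 0, inl (e y)); (inr 0, inr 1); (inr 0, inr 2);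
    (inl (e x), inr 1); (inl (e y), inr 2); (inr 1, inr 2); (inr 1, inr 2)] =
  [seq (surgery_label 2 x0 p.1, surgery_label 2 x0 p.2) | p <- block_edges b].
  by label_eq.
rewrite [X in replace _ _ _ X]E; apply: iso.
by case=> [w|[[|[|]] ?]] //; rewrite !inE.
Qed.

Lemma reduce_Fish x p q r :
    let b := Fish x p q r in
    obtained_below (total_weight (b :: bs)) ->
    all block_wf (b :: bs) -> regular 4 (list_graph (edges_of (b :: bs))) ->
  obtained_blocks (b :: bs).
Proof.
move=> b IH wf_bs reg_bs; have := wf_bs => /= /andP[wf_b wf_r].
rewrite /block_wf in wf_b; neq_facts wf_b.
pose nw := [:: p; q; r].
have xN : x \notin nw by rewrite !inE; neq_simp.
pose x0 : {t : T | t \notin nw} := exist _ x xN.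
pose e := embed 2 x0.
pose p1 : surgery_type nw 2 := inr ord0.
pose p2 : surgery_type nw 2 := inr (@Ordinal 2 1 isT).
pose obs := [:: Tail (e x) p1 p2].
have nw_uniq : uniq nw by rewrite /= !inE; neq_simp.
have nw_b : {in nw, forall n, count_mem n (endpoints (block_edges b)) = 4}.
  by move=> n; rewrite !inE => /or3P[]/eqP->; rewrite /= ; neq_simp.
apply: (reduce_block (x0 := x0) (obs := obs)) => //.
- by rewrite /total_weight !big_seq1.
- move=> t tN; rewrite /= !embed_eq //; move: tN;
    rewrite !inE !negb_or => /and3P[tu tv tw].
  by neq_simp; do ?case: (_ == _).
- by case=> -[|[|]].
left; constructor 3; exists (e x), p1, p2; split=> //.
split; first exact: (has_edges_of (obs := obs)).
have iso := surgery_replace (s :=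
  [seq (surgery_label 2 x0 p.1, surgery_label 2 x0 p.2) | p <- block_edges b])
    (obs := obs) (D := [set p1;
      p2]) (old := block_edges (Tail (e x) p1 p2)) nw_uniq reg_bs wf_bs nw_b _ _
        (erefl _).
have E : [:: (inl (e x), inr 0); (inl (e x), inr 1); (inr 0, inr 1);
  (inr 0, inr 2); (inr 0, inr 2); (inr 1, inr 2); (inr 1, inr 2)] =
  [seq (surgery_label 2 x0 p.1, surgery_label 2 x0 p.2) | p <- block_edges b].
  by label_eq.
rewrite [X in replace _ _ _ X]E; apply: iso => //.
by case=> [w|[[|[|]] ?]] //; rewrite !inE.
Qed.

Lemma reduce_Tail x p q :
    let b := Tail x p q in
    obtained_below (total_weight (b :: bs)) ->
    all block_wf (b :: bs) -> regular 4 (list_graph (edges_of (b :: bs))) ->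
  obtained_blocks (b :: bs).
Proof.
move=> b IH wf_bs reg_bs; have := wf_bs => /= /andP[wf_b wf_r].
rewrite /block_wf in wf_b; neq_facts wf_b.
pose nw := [:: p; q].
have xN : x \notin nw by rewrite !inE; neq_simp.
pose x0 : {t : T | t \notin nw} := exist _ x xN.
pose e := embed 4 x0.
pose p1 : surgery_type nw 4 := inr ord0.
pose p2 : surgery_type nw 4 := inr (@Ordinal 4 1 isT).
pose p3 : surgery_type nw 4 := inr (@Ordinal 4 2 isT).
pose p4 : surgery_type nw 4 := inr (@Ordinal 4 3 isT).
pose obs := [:: Tri (e x) p1 p2; Tri p1 p3 p4; Tri p2 p3 p4].
have nw_uniq : uniq nw by rewrite /= !inE; neq_simp.
have nw_b : {in nw, forall n, count_mem n (endpoints (block_edges b)) = 4}.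
  by move=> n; rewrite !inE => /orP[]/eqP->; rewrite /= ; neq_simp.
apply: (reduce_block (x0 := x0) (obs := obs)) => //.
- by rewrite /total_weight !big_cons !big_nil.
- move=> t tN; rewrite /= !embed_eq //; move: tN; rewrite !inE !negb_or => /andP[tu tv].
  by neq_simp; do ?case: (_ == _).
- by case=> -[|[|[|[|]]]].
right; exists (e x), p1, p2, p3, p4; split=> //.
split; first exact: (has_edges_of (obs := obs)) (@tail_edges _ _ _ _ _ _).
have iso := surgery_replace (s :=
  [seq (surgery_label 4 x0 p.1, surgery_label 4 x0 p.2) | p <- block_edges b])
    (obs := obs) (D := [set p1; p2; p3;
      p4]) nw_uniq reg_bs wf_bs nw_b _ (@tail_edges _ _ _ _ _ _) (erefl _).
have E : [:: (inl (e x), inr 0); (inl (e x), inr 1); (inr 0, inr 1);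
  (inr 0, inr 1); (inr 0, inr 1)] =
  [seq (surgery_label 4 x0 p.1, surgery_label 4 x0 p.2) | p <- block_edges b].
  by label_eq.
rewrite [X in replace _ _ _ X]E; apply: iso => //.
by case=> [w|[[|[|[|[|]]]] ?]] //; rewrite !inE.
Qed.
End Reductions.

Lemma blocks_obtained (T : finType) (t0 : T) (bs : seq (block T)) :
  all block_wf bs -> regular 4 (list_graph (edges_of bs)) -> obtained_blocks bs.
Proof.
have [n lt_n] := ubnP (total_weight bs); elim: n => // n IHn in T t0 bs lt_n *.
move=> wf_bs reg_bs.
have IH : obtained_below (total_weight bs).
  by move=> U u0 cs lt_cs; apply: IHn => //; apply: leq_trans lt_cs _.
have [bs_tri|] := boolP (all (@is_tri T) bs).
  exact: (triangles_obtained t0 wf_bs bs_tri reg_bs).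
rewrite -has_predC => /has_split[bs1 [b [bs2 [bsE b_tri]]]].
(* The reductions treat the head of the list; reordering the blocks changes neither multiplicities
   nor weight. *)
pose cs := b :: (bs1 ++ bs2).
have csE : edge_count (edges_of bs) =2 edge_count (edges_of cs).
  move=> x y; rewrite bsE !edge_count_edges_of big_cons !big_cat /= big_cons; lia.
have wE : total_weight bs = total_weight cs.
  by rewrite bsE /total_weight big_cons !big_cat /= big_cons; lia.
have wf_cs : all block_wf cs.
  by move: wf_bs; rewrite bsE /= !all_cat /= => /and3P[-> -> ->].
have reg_cs := list_graph_regular csE reg_bs.
suff [M [M3 obt]] : obtained_blocks cs.
  exists M; split=> //; apply: obtained_from_iso obt _.
  by apply: list_graph_iso => x y; rewrite csE.
rewrite wE in IH.
case: b @cs {wE csE bsE} b_tri wf_cs reg_cs IH => //= *.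
- exact: reduce_K113.
- exact: reduce_Fan.
- exact: reduce_Fish.
- exact: reduce_Tail.
Qed.

(** * Removing blocks *)

Section Neighbours.
Variable R : multigraph.
Implicit Types (x y z : R) (s t : seq R).

(** A neighbour list with multiplicity: once it is explicit, every multiplicity at [x] is computed
    by comparing vertices. *)
Definition nbrs x s := forall y, mult x y = count_mem y s.

Lemma nbrs_adj x s y : nbrs x s -> adjacent x y = (y \in s).
Proof. by move=> xs; rewrite /adjacent xs -has_count has_pred1. Qed.

Lemma adjC x y : adjacent x y = adjacent y x.
Proof. by rewrite /adjacent multC. Qed.

Lemma adj_neq x y : adjacent x y -> x != y.
Proof. by apply: contraTneq => ->; rewrite /adjacent multxx. Qed.

Lemma nbrs_size x s : nbrs x s -> size s = degree x.
Proof.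
move=> xs; rewrite /degree; under eq_bigr => y _ do rewrite xs.
elim: s {xs} => [|y s IHs] /=; first by rewrite big1.
rewrite big_split /= -IHs -[LHS]add1n; congr (_ + _).
by rewrite (bigD1 y) //= eqxx big1 // => z /negPf; rewrite eq_sym => ->.
Qed.

Lemma nbrs_exists x : exists s, nbrs x s.
Proof.
exists (flatten [seq nseq (mult x y) y | y <- enum R]) => y.
rewrite count_flatten -map_comp sumnE big_map big_enum /=.
rewrite (bigD1 y) //= count_nseq /= eqxx mul1n big1 ?addn0 // => z zy.
by rewrite count_nseq /= (negPf zy).
Qed.

Lemma nbrs_perm x s t : perm_eq s t -> nbrs x s -> nbrs x t.
Proof. by move=> /permP st xs y; rewrite xs st. Qed.

Lemma nbrs_pick x s y : nbrs x s -> y \in s ->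
  exists2 s', nbrs x (y :: s') & perm_eq s (y :: s').
Proof.
by move=> xs ys; exists (rem y s); [apply: (nbrs_perm _ xs)|]; apply: perm_to_rem.
Qed.

Lemma nbrs_pick1 x y : adjacent x y ->
  exists s, nbrs x (y :: s).
Proof.
have [s xs] := nbrs_exists x; rewrite (nbrs_adj _ xs) => /(nbrs_pick xs)[s' xs' _].
by exists s'.
Qed.

Lemma nbrs_pick2 x y z : adjacent x y -> adjacent x z -> y != z ->
  exists s, nbrs x (y :: z :: s).
Proof.
move=> /nbrs_pick1[s xs] xz yz; exists (rem z s); apply: (nbrs_perm _ xs).
rewrite perm_cons perm_to_rem //.
by move: xz; rewrite (nbrs_adj _ xs) inE eq_sym (negPf yz).
Qed.

Lemma nbrs_pick3 x y z w :
    adjacent x y -> adjacent x z -> adjacent x w -> y != z -> y != w -> z != w ->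
  exists s, nbrs x [:: y, z, w & s].
Proof.
move=> xy xz xw yz yw zw; have [s xs] := nbrs_pick2 xy xz yz.
exists (rem w s); apply: (nbrs_perm _ xs); rewrite !perm_cons perm_to_rem //.
by move: xw; rewrite (nbrs_adj _ xs) !inE ![w == _]eq_sym (negPf yw) (negPf zw).
Qed.

Definition removable (b : block R) :=
  [/\ block_wf b, has_edges (block_edges b)
    & triangle_property (remove_edges (block_edges b))].

(* Only the triangles that lose an edge xy matter: their remaining edges yz need
   another triangle. *)
Lemma removableI (b : block R) : triangle_property R ->
    block_wf b -> all (fun p => edge_count (block_edges b) p.1 p.2 <= mult p.1 p.2)
      (block_edges b) ->
    (forall x y z, ((x, y) \in block_edges b) || ((y, x) \in block_edges b) ->
       adjacent x y -> adjacent y z -> adjacent x z ->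
       mult x y <= edge_count (block_edges b) x y ->
       edge_count (block_edges b) y z < mult y z ->
       exists2 w, edge_count (block_edges b) y w < mult y w
                & edge_count (block_edges b) z w < mult z w) ->
  removable b.
Proof.
set s := block_edges b => R_tri wf_b /allP b_le cut; split=> // [x y|].
  have [|] := posnP (edge_count s x y); first by move->.
  rewrite edge_count_gt0 => /andP[_ /orP[]] /b_le //= le_yx.
  by rewrite edge_countC multC.
have adjE (u v : R) :
    @adjacent (remove_edges s) u v = (edge_count s u v < @mult R u v).
  exact: subn_gt0.
suff R_tri' (x y : R) : edge_count s x y < mult x y ->
    exists z, @triangle (remove_edges s) x y z.
  by move=> x y; rewrite adjE; apply: R_tri'.
move=> lt_xy.

have cut' (u v w : R) : adjacent u v -> adjacent v w -> adjacent u w ->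
    mult u v <= edge_count s u v -> edge_count s v w < mult v w ->
    exists2 t, edge_count s v t < mult v t & edge_count s w t < mult w t.
  move=> uv vw uw le_uv; apply: (cut u) => //.
  have : 0 < edge_count s u v by exact: (leq_trans uv le_uv).
  by rewrite edge_count_gt0 => /andP[].
have [z [xy yz zx]] := R_tri x y (leq_ltn_trans (leq0n _) lt_xy).
have sw (u v : R) : (edge_count s u v < mult u v) = (edge_count s v u < mult v u).
  by rewrite edge_countC multC.
(* If all copies of [yz] are deleted, the cut condition is applied to the lost edge [zy] and the
   surviving edge [yx]; it returns a new third vertex for [xy]. *)
have [le_yz|lt_yz] := leqP (mult y z) (edge_count s y z).
  have zy : adjacent z y by rewrite adjC.
  have yx : @adjacent R y x by rewrite adjC.
  have le_zy : mult z y <= edge_count s z y by rewrite multC edge_countC.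
  have lt_yx : edge_count s y x < @mult R y x by rewrite sw.
  have [t yt xt] := cut' z y x zy yx zx le_zy lt_yx.
  by exists t; split; rewrite adjE // sw.
have [le_xz|lt_xz] := leqP (mult z x) (edge_count s z x).
  have zy : adjacent z y by rewrite adjC.
  have [t xt yt] := cut' z x y zx xy zy le_xz lt_xy.
  by exists t; split; rewrite adjE // sw.
by exists z; split; rewrite adjE.
Qed.

End Neighbours.

Ltac nb_rw := repeat match goal with
  | H : nbrs ?x _ |- context [mult ?x ?y] => rewrite (H y)
  | H : nbrs ?x _ |- context [mult ?y ?x] => rewrite (multC y x) (H y)
  | H : mult ?x ?y = 0 |- context [mult ?x ?y] => rewrite H
  | H : mult ?x ?y = 0 |- context [mult ?y ?x] => rewrite (multC y x) H
  end.

Ltac known := rewrite /adjacent ?multxx; nb_rw; rewrite /edge_count /=; neq_simp.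

Ltac witness := match goal with
  | w : Finite.sort (vert _) |- _ => solve [exists w; known;
    first [done | assumption | rewrite multC; assumption]]
  end.

Ltac split_mem := rewrite ?inE; repeat case/orP; move=> /eqP->.

Ltac refute H := solve [exfalso; move: H; known; done].

(** For one edge [xy] of the block, an explicit neighbour list at [x] or [y] bounds the possible
    third vertices [z]. Each is refuted or given a replacement triangle among the named vertices;
    what remains is an adjacency [yz] that the lists do not decide. *)
Ltac removable_step :=
  case/andP => /eqP-> /eqP->;
  move=> _ /[swap];
  match goal with
  | H : nbrs ?x _ |- is_true (adjacent ?x _) -> _ => rewrite (nbrs_adj _ H); split_mem
  | H : nbrs ?y _ |- _ -> is_true (adjacent ?y _) -> _ =>
      move=> /[swap]; rewrite (nbrs_adj _ H); split_mem
  end;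
  let yz := fresh in let le := fresh in let lt := fresh in intros yz le lt;
  first [refute lt | refute yz | refute le | witness | revert yz; clear le lt].

Ltac removable_tac :=
  apply: removableI => //;
  [ by rewrite /block_wf /= !inE; neq_simp
  | by rewrite /=; known
  | let x := fresh "x" in let y := fresh "y" in let z := fresh "z" in
    move=> x y z; rewrite /= !inE !xpair_eqE; repeat case/orP; removable_step ].

Section RemovableBlocks.
Variable R : multigraph.
Hypothesis R_tri : triangle_property R.

Lemma nbrs_neqs (x : R) s : nbrs x s -> all (fun y => x != y) s.
Proof. by move=> xs; apply/allP => y; rewrite -(nbrs_adj _ xs); apply: adj_neq. Qed.

Lemma tail_removable (v a b : R) :
  nbrs a [:: v; b; b; b] -> nbrs b [:: v; a; a; a] -> removable (Tail v a b).
Proof.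
move=> a_nb b_nb.
have aN := nbrs_neqs a_nb; neq_facts aN.
have bN := nbrs_neqs b_nb; neq_facts bN.
removable_tac.
Qed.

Lemma fish_removable (x p q r : R) : uniq [:: x; p; q; r] ->
    nbrs p [:: x; q; r; r] -> nbrs q [:: x; p; r; r] -> nbrs r [:: p; p; q; q] ->
  removable (Fish x p q r).
Proof.
by move=> bN p_nb q_nb r_nb; neq_facts bN; removable_tac.
Qed.

(** All edges at [u], [v1], [v2] belong to the block, so the only outside edges that lose a triangle
    are those joining [x] and [y], through [u]. The last hypothesis supplies a substitute. *)
Lemma fan_removable (x y u v1 v2 : R) : uniq [:: x; y; u; v1; v2] ->
    nbrs u [:: x; y; v1; v2] -> nbrs v1 [:: u; x; v2; v2] -> nbrs v2 [:: u; y; v1;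
      v1] ->
    (adjacent x y -> exists w, [/\ w \notin [:: u; v1;
      v2], adjacent x w & adjacent y w]) ->
  removable (Fan x y u v1 v2).
Proof.
move=> bN u_nb v1_nb v2_nb xy_tri; neq_facts bN.
removable_tac; rewrite 1?[adjacent y x]adjC => /xy_tri[w [wN xw yw]];
  by neq_facts wN; have ? := adj_neq xw; have ? := adj_neq yw; exists w; known.
Qed.

(** All edges at [u] and [v] belong to the block, so only edges among [x], [y], [z] can lose
    triangles. *)
Lemma K113_removable (u v x y z : R) : uniq [:: x; y; z] ->
    nbrs u [:: v; x; y; z] -> nbrs v [:: u; x; y; z] ->
    {in [:: x; y; z] &, forall s t, adjacent s t ->
       exists w, [/\ w \notin [:: u; v], adjacent s w & adjacent t w]} ->
  removable (K113 u v x y z).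
Proof.
move=> bN u_nb v_nb tri; neq_facts bN.
have uN := nbrs_neqs u_nb; neq_facts uN.
have vN := nbrs_neqs v_nb; neq_facts vN.
removable_tac; match goal with |- is_true (adjacent ?s ?t) -> _ =>
  move=> st;
  have [||//|w [wN sw tw]] := tri s t; rewrite ?inE ?eqxx ?orbT //;
  have ? := adj_neq sw; have ? := adj_neq tw; neq_facts wN; exists w; known; done
end.
Qed.
End RemovableBlocks.

Ltac perm_tac := apply/permP => ? /=; clear; lia.

Ltac reorder H := apply: (nbrs_perm _ H); perm_tac.

(* Uses the neighbour list H' of v to show that v occurs only as often as H
   explicitly says in the neighbour list H. *)
Ltac not_nbr H H' v :=
  let E := fresh "E" in apply/eqP => E; have := H v;
    rewrite ?E ?[mult _ v]multC (H' _) /=; neq_simp; done.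

Ltac side := solve [done | rewrite eq_sym; done | rewrite adjC; done | known; done].

(** The main forcing device: the neighbours of a vertex induce a graph without isolated vertices, so
    when all but one candidate for an adjacency are excluded, the last one holds. *)
Lemma tri_in (R : multigraph) (x y : R) s : triangle_property R ->
  nbrs x s -> y \in s -> exists2 z, z \in s & adjacent y z.
Proof.
move=> R_tri x_nb; rewrite -(nbrs_adj _ x_nb) => /R_tri[z [xy yz zx]].
by exists z; rewrite // -(nbrs_adj _ x_nb) adjC.
Qed.

Section PeelMain.
Variable R : multigraph.
Hypothesis R_even : forall x : R, degree x \in [:: 0; 2; 4].
Hypothesis R_tri : triangle_property R.

Lemma even_nbrs_rest2 (x a b : R) s : nbrs x [:: a, b & s] ->
  s = [::] \/ exists c d, s = [:: c; d].
Proof.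
move=> x_nb; have := R_even x; rewrite -(nbrs_size x_nb).
by case: s {x_nb} => [|c [|d [|e s]]] //; [left|right; exists c, d].
Qed.

Lemma even_nbrs_rest1 (x a b c : R) s : nbrs x [:: a, b, c & s] -> exists d, s = [:: d].
Proof.
by move=> /even_nbrs_rest2[//|[c' [d [_ ->]]]]; exists d.
Qed.

Lemma nbrs_two_two (x a b : R) : a != b -> mult x a = 2 -> mult x b = 2 ->
  nbrs x [:: a; a; b; b].
Proof.
move=> ab xa xb; have [||//|s x_nb] := @nbrs_pick2 R x a b;
  rewrite /adjacent ?xa ?xb //.
have ba : b != a by rewrite eq_sym.
have [E|[c [d E]]] := even_nbrs_rest2 x_nb; subst s; move: xa xb; rewrite !x_nb /=;
  neq_simp => //.
have [E|ca] := eqVneq c a.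
  by subst c; neq_simp; have [E _ _|] := eqVneq d b; [subst d;
      reorder x_nb | case: eqP].
have [E|cb] := eqVneq c b; last by case: eqP => [->|//]; neq_simp.
by subst c; have [E _ _|] := eqVneq d a; [subst d; reorder x_nb | case: eqP].
Qed.

(** The double edge [aw] can only find its triangle at [b]. If [bw] is double too, the block is a
    [Fish]; otherwise the fourth edge [bc] needs [w] as third vertex, and a [Fan] appears. *)
Lemma peel_double (v a b w : R) : nbrs v [:: a; b] -> nbrs a [:: v; b; w; w] ->
  b != w -> exists e : block R, removable e.
Proof.
move=> v_nb a_nb bw.
have vN := nbrs_neqs v_nb; neq_facts vN.
have aN := nbrs_neqs a_nb; neq_facts aN.
have vw : v != w.
  by apply/eqP => E; have := a_nb v; rewrite multC v_nb -E /=; neq_simp.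
have bw' : adjacent w b.
  have [|z] := tri_in (y := w) R_tri a_nb; first by rewrite !inE eqxx !orbT.
  by split_mem; first [done | known].
have ab : adjacent b a by known.
have vb : adjacent b v by known.
have [s b_nb] : exists s, nbrs b [:: v, a, w & s] by apply: nbrs_pick3; side.
have [c E] := even_nbrs_rest1 b_nb; subst s.
have wa2 : mult w a = 2 by known.
have [E|cw] := eqVneq c w.
  subst c; have wb2 : mult w b = 2 by known.
  have w_nb : nbrs w [:: a; a; b; b] by apply: nbrs_two_two.
  by exists (Fish v a b w); apply: fish_removable => //=; rewrite !inE; neq_simp.
have cv : c != v by not_nbr b_nb v_nb v.
have ca : c != a by not_nbr b_nb a_nb a.
have bN := nbrs_neqs b_nb; neq_facts bN.
have cw' : adjacent c w.
  have [|z] := tri_in (y := c) R_tri b_nb; first by rewrite !inE eqxx !orbT.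
  by split_mem; first [done | known].
have [s w_nb] : exists s, nbrs w [:: a, b, c & s] by apply: nbrs_pick3; side.
have [d E] := even_nbrs_rest1 w_nb; subst s.
have da : d = a.
  by move: wa2; rewrite w_nb /=; neq_simp; case: eqP.
subst d.
exists (Fan v c b a w); apply: fan_removable => //=.
- by rewrite !inE; neq_simp.
- by reorder b_nb.
- by reorder a_nb.
- by reorder w_nb.
- by known.
Qed.
End PeelMain.

Section PeelMain.
Variable R : multigraph.
Hypothesis R_even : forall x : R, degree x \in [:: 0; 2; 4].
Hypothesis R_tri : triangle_property R.

Let pk4 := even_nbrs_rest2 R_even.
Let pk4' := even_nbrs_rest1 R_even.

(** The edges [aa'] and [bb'] can only lie in triangles with [w]. The triangles [awa'] and [bwb']
    survive and cover everything left at [a] and [b]. *)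
Lemma peel_one (v a b w a' b' : R) :
    uniq [:: v; a; b; w; a'; b'] -> nbrs v [:: a; b] ->
    nbrs a [:: v; b; w; a'] -> nbrs b [:: v; a; w; b'] ->
  exists e : block R, removable e.
Proof.
move=> uN v_nb a_nb b_nb; neq_facts uN.
have wa' : adjacent w a'.
  have [|z] := tri_in (y := a') R_tri a_nb; first by rewrite !inE eqxx !orbT.
  by split_mem; first [side | known].
have wb' : adjacent w b'.
  have [|z] := tri_in (y := b') R_tri b_nb; first by rewrite !inE eqxx !orbT.
  by split_mem; first [side | known].
rewrite /adjacent in wa' wb'.
exists (Tri v a b); removable_tac.
Qed.

Lemma peel_two (v a b x y : R) :
    uniq [:: v; x; y] -> nbrs v [:: a; b] ->
    nbrs a [:: v; b; x; y] -> nbrs b [:: v; a; x; y] ->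
  exists e : block R, removable e.
Proof.
move=> uN v_nb a_nb b_nb; neq_facts uN.
have vN := nbrs_neqs v_nb; neq_facts vN.
have aN := nbrs_neqs a_nb; neq_facts aN.
have bN := nbrs_neqs b_nb; neq_facts bN.
(* If [xy] is double, the neighbours of [x] are [a], [b], [y], [y], and removing the whole [K113]
   would strand [xy]. Then only [vab] is removed, and [axy] and [bxy] cover the rest. *)
have [xy1|xy1] := ltnP 1 (mult x y).
  have xy0 : 0 < mult x y by apply: ltnW.
  exists (Tri v a b); removable_tac.
exists (K113 a b v x y).
have xy_w : adjacent x y -> exists w, [/\ w \notin [:: a;
  b], adjacent x w & adjacent y w].
  move=> xy; have [s x_nb] : exists s, nbrs x [:: a, b, y &
    s] by apply: nbrs_pick3; side.
  have [w E] := pk4' x_nb; subst s.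
  have xN := nbrs_neqs x_nb; neq_facts xN.
  have wy : w != y.
    by move: xy1; rewrite x_nb /=; neq_simp; case: (w == y).
  have wv : w != v by not_nbr x_nb v_nb v.
  have wa : w != a by not_nbr x_nb a_nb a.
  have wb : w != b by not_nbr x_nb b_nb b.
  exists w; split; [by rewrite !inE; neq_simp | by known | ].
  have [|z] := tri_in (y := w) R_tri x_nb; first by rewrite !inE eqxx !orbT.
  by split_mem; first [side | known].
apply: K113_removable; rewrite ?/= ?inE; neq_simp => //.
- by reorder a_nb.
- by reorder b_nb.
move=> s t; rewrite !inE => /or3P[]/eqP-> /or3P[]/eqP->; 
  first [by known | exact: xy_w | by rewrite adjC => /xy_w[w [? ? ?]]; exists w].
Qed.

Lemma peel (v : R) : degree v = 2 -> exists e : block R, removable e.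
Proof.
move=> deg_v; have [s v_nb] := nbrs_exists v.
move: (nbrs_size v_nb); rewrite deg_v.
case: s v_nb => [|a [|b []]] // v_nb _.
have vN := nbrs_neqs v_nb; neq_facts vN.
have [ab ab'] : a != b /\ adjacent a b.
  have [|z] := tri_in (y := a) R_tri v_nb; first by rewrite !inE eqxx.
  split_mem; first by rewrite /adjacent multxx.
  by move=> ab; split=> //; apply: adj_neq.
have [sa a_nb] : exists s, nbrs a [:: v, b & s] by apply: nbrs_pick2; side.
have [sb b_nb] : exists s, nbrs b [:: v, a & s] by apply: nbrs_pick2; side.
have [E|[a1 [a2 E]]] := pk4 a_nb; subst sa.
  by clear b_nb; exists (Tri v a b); removable_tac.
have [E|[b1 [b2 E]]] := pk4 b_nb; subst sb.
  by clear a_nb; exists (Tri v a b); removable_tac.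
have aN := nbrs_neqs a_nb; neq_facts aN.
have bN := nbrs_neqs b_nb; neq_facts bN.
have va1 : v != a1 by rewrite eq_sym; not_nbr a_nb v_nb v.
have va2 : v != a2 by rewrite eq_sym; not_nbr a_nb v_nb v.
have vb1 : v != b1 by rewrite eq_sym; not_nbr b_nb v_nb v.
have vb2 : v != b2 by rewrite eq_sym; not_nbr b_nb v_nb v.

(* Parallel edges between [a] and [b]: a triple edge gives a [Tail]; for a double edge the remaining
   neighbours of [a] and [b] coincide, and their triangle keeps the second copy of [ab] covered. *)
have [ab1|ab1] := boolP (b \in [:: a1; a2]).
  have [a' a_nb'] : exists a', nbrs a [:: v; b; b; a'].
    move: ab1; rewrite !inE => /orP[]/eqP E; rewrite -E in a_nb; first by exists a2.
    by exists a1; reorder a_nb.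
  have ab2 : 1 < mult a b by rewrite a_nb' /=; neq_simp.
  have [b' b_nb'] : exists b', nbrs b [:: v; a; a; b'].
    move: ab2; rewrite multC b_nb /=; neq_simp.
    have [E _|] := eqVneq b1 a; first by exists b2; rewrite -{2}E.
    have [E _ _|//] := eqVneq b2 a; exists b1; rewrite -{2}E; reorder b_nb.
  move=> {ab2 aN bN N2 N5 va1 va2 vb1 vb2 ab1 a1 a2 b1 b2 a_nb b_nb}.
  have aN := nbrs_neqs a_nb'; neq_facts aN.
  have bN := nbrs_neqs b_nb'; neq_facts bN.
  have := a_nb' b; rewrite multC b_nb' /=; neq_simp.
  have [E|a'b] := eqVneq a' b.
    have [E' _|//] := eqVneq b' a; subst.
    by exists (Tail v a b); apply: tail_removable.
  have [//|b'a _] := eqVneq b' a.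
  have a'v : a' != v by not_nbr a_nb' v_nb v.
  have b'v : b' != v by not_nbr b_nb' v_nb v.
  have E : b' = a'.
    apply/eqP; have [|z] := tri_in (y := a') R_tri a_nb';
      first by rewrite !inE eqxx !orbT.
    by split_mem; known => //; case: (b' == a').
  subst b'; exists (Tri v a b); removable_tac.
have ba1 : a \notin [:: b1; b2].
  move: ab1; have := a_nb b; rewrite multC b_nb /=; neq_simp; rewrite !inE.
  by rewrite ![_ == b]eq_sym ![_ == a]eq_sym;
    case: (b == a1); case: (b == a2); case: (a == b1); case: (a == b2).
neq_facts ab1; neq_facts ba1.
have [E|a12] := eqVneq a1 a2; first by subst a2;
  apply: (peel_double R_even R_tri v_nb a_nb).
have [E|b12] := eqVneq b1 b2.
  have v_nb' : nbrs v [:: b; a] by reorder v_nb.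
  by subst b2; apply: (peel_double R_even R_tri v_nb' b_nb).
(* Now all neighbours are distinct, and the case depends on how many common neighbours [a] and [b]
   have besides [v]: two, one or none. With none, [vab] is the only triangle on [ab]. *)
have [a1b|a1b] := boolP (a1 \in [:: b1; b2]);
  have [a2b|a2b] := boolP (a2 \in [:: b1; b2]).
- have b_nb' : nbrs b [:: v; a; a1; a2].
    move: a1b a2b; rewrite !inE => /orP[]/eqP E1 /orP[]/eqP E2; subst => //.
    all: rewrite ?eqxx in a12 => //.
    by reorder b_nb.
  by apply: (peel_two _ v_nb a_nb b_nb'); rewrite /= !inE; neq_simp.
- have [b' b_nb' b'N] : exists2 b', nbrs b [:: v; a; a1;
    b'] & (b' != a1) && (b' \in [:: b1; b2]).
    move: a1b; rewrite !inE => /orP[]/eqP E; subst a1.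
      by exists b2; rewrite // !inE eqxx orbT eq_sym b12.
    by exists b1; [reorder b_nb | rewrite !inE eqxx b12].
  apply: (peel_one _ v_nb a_nb b_nb'); move: b'N;
    rewrite /= !inE => /andP[b'a1 /orP[]/eqP E]; subst b';
    neq_facts a2b; neq_simp => //.
- have [b' b_nb' b'N] : exists2 b', nbrs b [:: v; a; a2;
    b'] & (b' != a2) && (b' \in [:: b1; b2]).
    move: a2b; rewrite !inE => /orP[]/eqP E; subst a2.
      by exists b2; rewrite // !inE eqxx orbT eq_sym b12.
    by exists b1; [reorder b_nb | rewrite !inE eqxx b12].
  have a_nb' : nbrs a [:: v; b; a2; a1] by reorder a_nb.
  apply: (peel_one _ v_nb a_nb' b_nb'); move: b'N;
    rewrite /= !inE => /andP[b'a1 /orP[]/eqP E]; subst b';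
    neq_facts a1b; neq_simp => //.
- neq_facts a1b; neq_facts a2b; exists (Tri v a b); removable_tac.
Qed.
End PeelMain.

(** * The first block: multiple edges *)

Section MultiEdge.
Variable G : multigraph.
Hypothesis G4 : regular 4 G.
Hypothesis G_tri : triangle_property G.

Lemma nbrs_size4 (x : G) s : nbrs x s -> size s = 4.
Proof. by move=> x_nb; rewrite (nbrs_size x_nb) G4. Qed.

Lemma nbrs_rest1 (x a b c : G) s : nbrs x [:: a, b, c & s] -> exists d, s = [:: d].
Proof. by move=> /nbrs_size4; case: s => [|d [|? ?]] //; exists d. Qed.

Lemma nbrs_rest2 (x a b : G) s : nbrs x [:: a, b & s] -> exists c d, s = [:: c; d].
Proof. by move=> /nbrs_size4; case: s => [|c [|d [|? ?]]] //; exists c, d. Qed.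

Lemma nbrs_double (x a : G) : 1 < mult x a -> exists b c, nbrs x [:: a; a; b; c].
Proof.
move=> xa; have [|s x_nb] := @nbrs_pick1 G x a; first by apply: ltnW.
have a_s : a \in s.
  by move: xa; rewrite x_nb /= eqxx add1n ltnS -has_count has_pred1.
have x_nb' : nbrs x [:: a, a & rem a s].
  by apply: (nbrs_perm _ x_nb); rewrite perm_cons perm_to_rem.
have [b [c E]] := nbrs_rest2 x_nb'; exists b, c; by rewrite E in x_nb'.
Qed.

Lemma triple_removable (v a c : G) : nbrs v [:: a; a; a;
  c] -> exists e : block G, removable e.
Proof.
move=> v_nb; have vN := nbrs_neqs v_nb; neq_facts vN.
have ac : adjacent a c.
  have [|z] := tri_in (y := a) G_tri v_nb; first by rewrite !inE eqxx.
  by split_mem; first [done | rewrite /adjacent multxx].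
have ca := adj_neq ac.
have av2 : 1 < mult a v by known.
have [b' [c' a_nb]] := nbrs_double av2.
have a_nb' : nbrs a [:: c; v; v; v].
  have := a_nb v; rewrite multC v_nb /=; neq_simp.
  move: ac; rewrite (nbrs_adj _ a_nb) !inE; neq_simp => ac av.
  have cv : c != v by rewrite eq_sym.
  move: ac av; rewrite ?(negPf cv) /=; have [E|b'v] := eqVneq b' v.
    by subst b'; neq_simp => /eqP E _; rewrite -E in a_nb; reorder a_nb.
  have [E|//] := eqVneq c' v; subst c'; neq_simp; rewrite orbF => /eqP E _;
    rewrite -E in a_nb.
  by reorder a_nb.
by exists (Tail c v a); apply: tail_removable => //; reorder v_nb.
Qed.

Lemma double_double_removable (v a b : G) : a != b -> nbrs v [:: a; a; b; b] ->
  exists e : block G, removable e.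
Proof.
move=> ab v_nb; have vN := nbrs_neqs v_nb; neq_facts vN.
have ab' : adjacent a b.
  have [|z] := tri_in (y := a) G_tri v_nb; first by rewrite !inE eqxx.
  by split_mem; first [done | rewrite /adjacent multxx].
have [s a_nb] : exists s, nbrs a [:: b, v & s] by apply: nbrs_pick2; side.
have [s' b_nb] : exists s', nbrs b [:: a, v & s'] by apply: nbrs_pick2; side.
have [a1 [a2 E]] := nbrs_rest2 a_nb; subst s.
have [b1 [b2 E]] := nbrs_rest2 b_nb; subst s'.
have [a' a_nb'] : exists a', nbrs a [:: v; v; b; a'].
  have := a_nb v; rewrite multC v_nb /=; neq_simp.
  have [E _|_] := eqVneq a1 v; first by exists a2; subst a1; reorder a_nb.
  by have [E _|//] := eqVneq a2 v; exists a1; subst a2; reorder a_nb.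
have [b' b_nb'] : exists b', nbrs b [:: v; v; a; b'].
  have := b_nb v; rewrite multC v_nb /=; neq_simp.
  have [E _|_] := eqVneq b1 v; first by exists b2; subst b1; reorder b_nb.
  by have [E _|//] := eqVneq b2 v; exists b1; subst b2; reorder b_nb.
clear a_nb b_nb.
have aN := nbrs_neqs a_nb'; neq_facts aN.
have bN := nbrs_neqs b_nb'; neq_facts bN.
(* The equality makes the three vertices a triangle with every edge doubled; removing one triangle
   leaves the other. *)
have [E|a'b] := eqVneq a' b.
  subst a'; have E : b' = a.
    by have := a_nb' b; rewrite multC b_nb' /=; neq_simp; case: eqP.
  by subst b'; exists (Tri v a b); removable_tac.
have a'v : a' != v by not_nbr a_nb' v_nb v.
have E : b' = a'.
  apply/eqP; have [|z] := tri_in (y := a') G_tri a_nb';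
    first by rewrite !inE eqxx !orbT.
  by split_mem; known => //; case: (b' == a').
subst b'; exists (Fish a' a b v); apply: fish_removable => //.
- by rewrite /= !inE; neq_simp.
- by reorder a_nb'.
- by reorder b_nb'.
Qed.

(** The further edge at [a] goes to some [d]. If [d = b] this is a [Fish]; otherwise the fourth edge
    of [b] must also end at [d], and the edges at [v], [a], [b] form a [Fan] with ends [c] and [d].
    Removal fails only if [cd] is an edge with no third vertex but [b], which forces [cd] to be
    double: the pattern of [F5]. *)
Lemma path_link_removable (v a b c : G) : uniq [:: a; b; c] ->
    nbrs v [:: a; a; b; c] -> adjacent a b -> mult a c = 0 ->
  (exists e : block G, removable e) \/
  exists d, [/\ uniq [:: v; a; b; c; d], nbrs a [:: v; v; b; d], nbrs b [:: v; a; c; d],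
     nbrs c [:: b; v; d; d] & nbrs d [:: a; b; c; c]].
Proof.
move=> uN v_nb ab ac; neq_facts uN; have vN := nbrs_neqs v_nb; neq_facts vN.
have bc : adjacent b c.
  have [|z] := tri_in (y := c) G_tri v_nb; first by rewrite !inE eqxx !orbT.
  by split_mem; first [side | known].
have [s a_nb] : exists s, nbrs a [:: b, v & s] by apply: nbrs_pick2; side.
have [a1 [a2 E]] := nbrs_rest2 a_nb; subst s.
have [d a_nb'] : exists d, nbrs a [:: v; v; b; d].
  have := a_nb v; rewrite multC v_nb /=; neq_simp.
  have [E _|_] := eqVneq a1 v; first by exists a2; subst a1; reorder a_nb.
  by have [E _|//] := eqVneq a2 v; exists a1; subst a2; reorder a_nb.
clear a_nb; have aN := nbrs_neqs a_nb'; neq_facts aN.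
have [s b_nb] : exists s, nbrs b [:: v, a, c & s] by apply: nbrs_pick3; side.
have [d' E] := nbrs_rest1 b_nb; subst s.
have bN := nbrs_neqs b_nb; neq_facts bN.
have dv : d != v by not_nbr a_nb' v_nb v.
have dc : d != c.
  by apply/eqP => E; move: ac; rewrite a_nb' E /= eqxx; neq_simp.
have [E|db] := eqVneq d b.
  left; subst d; have E : d' = a.
    by have := a_nb' b; rewrite multC b_nb /=; neq_simp; case: eqP.
  subst d'; exists (Fish c v b a); apply: fish_removable => //.
  - by rewrite /= !inE; neq_simp.
  - by reorder v_nb.
  - by reorder b_nb.
have E : d' = d.
  apply/eqP; have [|z] := tri_in (y := d) G_tri a_nb'; first by rewrite !inE eqxx !orbT.
  by split_mem; known => //; case: (d' == d).
subst d'.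
have fan : (adjacent c d -> exists w, [/\ w \notin [:: b; v;
  a], adjacent c w & adjacent d w]) ->
    removable (Fan c d b v a).
  move=> ?; apply: fan_removable => //.
  - by rewrite /= !inE; neq_simp.
  - by reorder b_nb.
  - by reorder v_nb.
  - by reorder a_nb'.
have [cd|cd] := boolP (adjacent c d); last first.
  by left; exists (Fan c d b v a); apply: fan => // cd'; rewrite cd' in cd.
have [s c_nb] : exists s, nbrs c [:: b, v, d & s] by apply: nbrs_pick3; side.
have [s' d_nb] : exists s', nbrs d [:: a, b, c & s'] by apply: nbrs_pick3; side.
have [c' E] := nbrs_rest1 c_nb; subst s.
have [d' E] := nbrs_rest1 d_nb; subst s'.
have cN := nbrs_neqs c_nb; neq_facts cN.
have dN := nbrs_neqs d_nb; neq_facts dN.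
have [E|c'd] := eqVneq c' d.
  right; exists d; subst c'; have E : d' = c.
    by have := c_nb d; rewrite multC d_nb /=; neq_simp; case: eqP.
  by subst d'; split=> //; rewrite /= !inE; neq_simp.
left; exists (Fan c d b v a); apply: fan => // _.
have c'v : c' != v by not_nbr c_nb v_nb v.
have c'b : c' != b by not_nbr c_nb b_nb b.
have c'a : c' != a.
  by apply/eqP => E; move: ac; rewrite multC c_nb E /= eqxx; neq_simp.
exists c'; split; [by rewrite !inE; neq_simp | by known |].
have [|z] := tri_in (y := c') G_tri c_nb; first by rewrite !inE eqxx !orbT.
by split_mem; first [side | known].
Qed.

(** The outcome depends on [bc]. If absent, [vab] can go, as [vac] keeps the second copy of [va]
    covered. If single, the fourth neighbours of [b] and [c] coincide and their triangle with [bc]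
    can go. If double, the pattern of the squared 4-cycle results. *)
Lemma triangle_link_removable (v a b c : G) : uniq [:: a; b; c] ->
    nbrs v [:: a; a; b; c] -> adjacent a b -> adjacent a c ->
  (exists e : block G, removable e) \/
  [/\ uniq [:: v; a; b; c], nbrs a [:: v; v; b; c], nbrs b [:: v; a; c;
    c] & nbrs c [:: v; a; b; b]].
Proof.
move=> uN v_nb ab ac; neq_facts uN; have vN := nbrs_neqs v_nb; neq_facts vN.
have [s a_nb] : exists s, nbrs a [:: v, b, c & s] by apply: nbrs_pick3; side.
have [a' E] := nbrs_rest1 a_nb; subst s.
have E : a' = v.
  by have := a_nb v; rewrite multC v_nb /=; neq_simp; case: eqP.
subst a'; have a_nb' : nbrs a [:: v; v; b; c] by reorder a_nb.
clear a_nb; have [bc0|bc] := posnP (mult b c).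
  by left; exists (Tri v a b); removable_tac.
have [s b_nb] : exists s, nbrs b [:: v, a, c & s] by apply: nbrs_pick3; side.
have [s' c_nb] : exists s', nbrs c [:: v, a, b & s'] by apply: nbrs_pick3; side.
have [b' E] := nbrs_rest1 b_nb; subst s.
have [c' E] := nbrs_rest1 c_nb; subst s'.
have aN := nbrs_neqs a_nb'; neq_facts aN.
have bN := nbrs_neqs b_nb; neq_facts bN.
have cN := nbrs_neqs c_nb; neq_facts cN.
have [E|b'c] := eqVneq b' c.
  right; subst b'; have E : c' = b.
    by have := b_nb c; rewrite multC c_nb /=; neq_simp; case: eqP.
  by subst c'; split=> //; rewrite /= !inE; neq_simp.
have b'v : b' != v by not_nbr b_nb v_nb v.
have b'a : b' != a by not_nbr b_nb a_nb' a.
have E : c' = b'.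
  apply/eqP; have [|z] := tri_in (y := b') G_tri b_nb; first by rewrite !inE eqxx !orbT.
  by split_mem; known => //; case: (c' == b').
by subst c'; left; exists (Tri b' b c); removable_tac.
Qed.
End MultiEdge.

Lemma connected_closed (G : multigraph) (s : seq G) (x : G) : connected G -> x \in s ->
  (forall y z : G, y \in s -> adjacent y z -> z \in s) -> forall y, y \in s.
Proof.
move=> [_ conn] xs closed y; have /connectP[p xp ->] := conn x y.
elim: p x xs xp => //= z p IHp x xs /andP[xz zp].
by apply: IHp zp; apply: closed xz.
Qed.

Lemma nth_bij (T : finType) (x0 : T) (s : seq T) (n : nat) : uniq s -> size s = n ->
  (forall x, x \in s) -> bijective (fun i : 'I_n => nth x0 s i).
Proof.
move=> s_uniq <- s_full; apply: inj_card_bij => [i j /eqP|].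
  by rewrite nth_uniq // => /eqP/val_inj.
by rewrite card_ord -(card_uniqP s_uniq); apply/subset_leq_card/subsetP.
Qed.

Definition sqcycle4_edges : seq (nat * nat) :=
  [:: (0, 1); (1, 2); (2, 3); (3, 0); (0, 2); (0, 2); (1, 3); (1, 3)].

Lemma sqcycle4_mult (i j : 'I_4) :
  @mult (sqcycle 4) i j = edge_count sqcycle4_edges i j.
Proof.
by case: i => [[|[|[|[|i]]]] lt_i] //; case: j => [[|[|[|[|j]]]] lt_j] //; vm_compute.
Qed.

Lemma operation4_F5 : operation4 (sqcycle 4) F5.
Proof.
pose z (k : nat) (lt_k : k < 4) : sqcycle 4 := Ordinal lt_k : 'I_4.
pose x := @z 0 isT; pose y := @z 2 isT; pose u := @z 1 isT; pose v := @z 3 isT.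
exists x, y, u, v; split; first by vm_compute.
split=> [a b|].
  rewrite (sqcycle4_mult a b); move: a b.
  by case=> [[|[|[|[|i]]]] lt_i] //; case=> [[|[|[|[|j]]]] lt_j] //; vm_compute.
have xD : x \notin [set u; v] by rewrite !inE.
have yD : y \notin [set u; v] by rewrite !inE.
set K := replace _ _ _ _.
pose f (i : 'I_5) : K := match val i with
  | 0 => inl (exist _ x xD)
  | 1 => inl (exist _ y yD)
  | 2 => inr (@Ordinal 3 0 isT)
  | 3 => inr (@Ordinal 3 1 isT)
  | _ => inr (@Ordinal 3 2 isT)
  end.
exists (f : F5 -> K).
  apply: inj_card_bij.
    by case=> [[|[|[|[|[|i]]]]] lt_i] //; case=> [[|[|[|[|[|j]]]]] lt_j] //= _;
        apply: val_inj.
  rewrite [X in X <= _]/= card_sum !card_ord card_sig.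
  rewrite (@eq_card _ _ [set x; y]) ?cards2 // => i; rewrite !inE.
  by case: i => [[|[|[|[|i]]]] lt_i].
by case=> [[|[|[|[|[|i]]]]] lt_i] //; case=> [[|[|[|[|[|j]]]]] lt_j] //; vm_compute.
Qed.

Section MultiEdgeCases.
Variable G : multigraph.
Hypothesis G_conn : connected G.
Hypothesis G4 : regular 4 G.
Hypothesis G_tri : triangle_property G.

Lemma sqcycle4_iso (v a b c : G) :
    uniq [:: v; a; b; c] -> nbrs v [:: a; a; b; c] -> nbrs a [:: v; v; b; c] ->
    nbrs b [:: v; a; c; c] -> nbrs c [:: v; a; b; b] ->
  isomorphic G (sqcycle 4).
Proof.
move=> uN v_nb a_nb b_nb c_nb; neq_facts uN.
have s_full x : x \in [:: v; b; a; c].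
  apply: (connected_closed (x := v)) => //; first by rewrite inE eqxx.
  move=> y z; rewrite !inE => /or4P[]/eqP->; rewrite (nbrs_adj _ v_nb, nbrs_adj _ b_nb,
    nbrs_adj _ a_nb, nbrs_adj _ c_nb);
  by split_mem; rewrite ?inE eqxx ?orbT.
(* The double edges [va] and [bc] are the diagonals, so the cyclic order is [v], [b], [a], [c]. *)
apply: iso_sym; exists (fun i : sqcycle 4 => nth v [:: v; b; a; c] (i : 'I_4)).
  by apply: nth_bij => //; rewrite /= !inE; neq_simp.
move=> i j; rewrite (sqcycle4_mult i j); move: i j.
by case=> [[|[|[|[|i]]]] lt_i] //; case=> [[|[|[|[|j]]]] lt_j] //; rewrite /=; known.
Qed.

Lemma F5_iso (v a b c d : G) :
    uniq [:: v; a; b; c; d] -> nbrs v [:: a; a; b; c] -> nbrs a [:: v; v; b; d] ->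
    nbrs b [:: v; a; c; d] -> nbrs c [:: b; v; d; d] -> nbrs d [:: a; b; c; c] ->
  isomorphic G F5.
Proof.
move=> uN v_nb a_nb b_nb c_nb d_nb; neq_facts uN.
have s_full x : x \in [:: c; d; b; v; a].
  apply: (connected_closed (x := v)) => //; first by rewrite !inE eqxx !orbT.
  move=> y z; rewrite !inE => /orP[|/or4P[]]/eqP->;
    rewrite (nbrs_adj _ v_nb, nbrs_adj _ b_nb,
    nbrs_adj _ a_nb, nbrs_adj _ c_nb, nbrs_adj _ d_nb);
  by split_mem; rewrite ?inE eqxx ?orbT.
apply: iso_sym; exists (fun i : F5 => nth v [:: c; d; b; v; a] (i : 'I_5)).
  by apply: nth_bij => //; rewrite /= !inE; neq_simp.
by case=> [[|[|[|[|[|i]]]]] lt_i] //; case=> [[|[|[|[|[|j]]]]] lt_j] //;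
    rewrite /=; known.
Qed.

Lemma multi_edge_cases (v a : G) : 1 < mult v a ->
  [\/ exists e : block G, removable e, isomorphic G (sqcycle 4) | isomorphic G F5].
Proof.
move=> /(nbrs_double G4)[b [c v_nb]].
have ac_case : forall a b c : G, uniq [:: a; b; c] -> nbrs v [:: a; a; b;
  c] -> adjacent a b ->
    [\/ exists e : block G, removable e, isomorphic G (sqcycle 4) | isomorphic G F5].
  move=> {v_nb b c} {}a b c uN v_nb ab; have [ac|ac] := posnP (mult a c).
    have [|[d [? ? ? ? ?]]] := path_link_removable G4 G_tri uN v_nb ab ac;
      first by constructor 1.
    by constructor 3; apply: (@F5_iso v a b c d).
  have [|[? ? ? ?]] := triangle_link_removable G4 G_tri uN v_nb ab ac;
    first by constructor 1.
  by constructor 2; apply: (@sqcycle4_iso v a b c).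
have [E|ba] := eqVneq b a; first by subst b; constructor 1;
  apply: (triple_removable G4 G_tri v_nb).
have [E|ca] := eqVneq c a.
  subst c; have v_nb' : nbrs v [:: a; a; a; b] by reorder v_nb.
  by constructor 1; apply: (triple_removable G4 G_tri v_nb').
have ab : a != b by rewrite eq_sym.
have [E|bc] := eqVneq b c.
  by subst c; constructor 1; apply: (double_double_removable G4 G_tri ab v_nb).
have v_nb' : nbrs v [:: a; a; c; b] by reorder v_nb.
(* The edge [va] has its triangle at [b] or at [c]; the two are interchangeable, which leaves
   [ac_case]. *)
have [|z] := tri_in (y := a) G_tri v_nb; first by rewrite !inE eqxx.
split_mem.
- by rewrite /adjacent multxx.
- by rewrite /adjacent multxx.
- by apply: ac_case v_nb; rewrite /= !inE; neq_simp.
- by apply: ac_case v_nb'; rewrite /= !inE; neq_simp.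
Qed.
End MultiEdgeCases.

(** * The first block: simple graphs *)

Section Simple.
Variable G : multigraph.
Hypothesis G4 : regular 4 G.
Hypothesis G_tri : triangle_property G.
Hypothesis G_simple : forall x y : G, mult x y <= 1.

Lemma nbrs_uniq (x : G) s : nbrs x s -> uniq s.
Proof.
move=> x_nb; apply: count_mem_uniq => y; have := G_simple x y; rewrite x_nb.
by rewrite -has_pred1 has_count; case: (count _ _) => [|[]].
Qed.

Lemma mult_adj (x y : G) : mult x y = adjacent x y.
Proof. by rewrite /adjacent; have := G_simple x y; case: (mult x y) => [|[]]. Qed.

Lemma isolated_triangle_removable (a b c : G) : triangle a b c ->
    (forall z, adjacent a z -> adjacent b z -> z = c) ->
    (forall z, adjacent b z -> adjacent c z -> z = a) ->
    (forall z, adjacent c z -> adjacent a z -> z = b) ->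
  removable (Tri a b c).
Proof.
case=> ab bc ca abc bca cab.
have N1 := adj_neq ab; have N2 := adj_neq bc; have N3 := adj_neq ca.
apply: removableI => //.
- by rewrite /block_wf /= !inE; neq_simp.
- by rewrite /= !mult_adj ab bc ca /edge_count /=; neq_simp.
move=> x y z; rewrite /= !inE !xpair_eqE.
repeat case/orP; case/andP => /eqP-> /eqP-> _ yz xz _.
Ltac kill_third E := rewrite E mult_adj /edge_count /=; neq_simp;
  by case: (adjacent _ _).
- by kill_third (abc z xz yz).
- by kill_third (bca z xz yz).
- by kill_third (cab z xz yz).
- by kill_third (abc z yz xz).
- by kill_third (bca z yz xz).
- by kill_third (cab z yz xz).
Qed.

(** The fourth neighbour [x'] of [x] either is joined to [y] or, since its edge needs a triangle,
    equals [z]. In the latter case the fourth neighbour of [y] is not [z], and its edge to [y] has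
    no triangle. *)
Lemma cone_pair (u v x y z : G) :
    nbrs u [:: v; x; y; z] -> nbrs v [:: u; x; y; z] -> adjacent x y ->
  exists w, [/\ w \notin [:: u; v], adjacent x w & adjacent y w].
Proof.
move=> u_nb v_nb xy.
have uN := nbrs_neqs u_nb; neq_facts uN.
have vN := nbrs_neqs v_nb; neq_facts vN.
have uU := nbrs_uniq u_nb; neq_facts uU.
have [s x_nb] : exists s, nbrs x [:: u, v, y & s] by apply: nbrs_pick3; side.
have [s' y_nb] : exists s, nbrs y [:: u, v, x & s] by apply: nbrs_pick3; side.
have [x' E] := nbrs_rest1 G4 x_nb; subst s.
have [y' E] := nbrs_rest1 G4 y_nb; subst s'.
have xU := nbrs_uniq x_nb; neq_facts xU.
have yU := nbrs_uniq y_nb; neq_facts yU.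
have xN := nbrs_neqs x_nb; neq_facts xN.
have yN := nbrs_neqs y_nb; neq_facts yN.
have [yx'|yx'] := boolP (adjacent y x').
  by exists x'; split=> //; [rewrite !inE; neq_simp | known].
have [x'z|x'z] := eqVneq x' z; last first.
  exfalso; have [|t] := tri_in (y := x') G_tri x_nb; first by rewrite !inE eqxx !orbT.
  by split_mem; [known | known | rewrite adjC (negPf yx') | rewrite /adjacent multxx].
subst x'; have y'z : y' != z.
  by apply: contraNneq yx' => <-; rewrite (nbrs_adj _ y_nb) !inE eqxx !orbT.
exfalso; have [|t] := tri_in (y := y') G_tri y_nb; first by rewrite !inE eqxx !orbT.
by split_mem; known.
Qed.

Lemma cone_removable (u v x y z : G) :
    nbrs u [:: v; x; y; z] -> adjacent v x -> adjacent v y -> adjacent v z ->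
  exists e : block G, removable e.
Proof.
move=> u_nb vx vy vz; have uU := nbrs_uniq u_nb; neq_facts uU.
have [s v_nb] : exists s, nbrs v [:: x, y, z & s] by apply: nbrs_pick3; side.
have [u' E] := nbrs_rest1 G4 v_nb; subst s.
have vu : u \in [:: x; y; z; u'].
  by rewrite -(nbrs_adj _ v_nb) adjC (nbrs_adj _ u_nb) inE eqxx.
have uN := nbrs_neqs u_nb; neq_facts uN.
have E : u' = u by move: vu; rewrite !inE; neq_simp; rewrite eq_sym => /eqP.
subst u'; have v_nb' : nbrs v [:: u; x; y; z] by reorder v_nb.
have u_nb2 : nbrs u [:: v; x; z; y] by reorder u_nb.
have v_nb2 : nbrs v [:: u; x; z; y] by reorder v_nb.
have u_nb3 : nbrs u [:: v; y; z; x] by reorder u_nb.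
have v_nb3 : nbrs v [:: u; y; z; x] by reorder v_nb.
exists (K113 u v x y z); apply: K113_removable => //.
  by rewrite /= !inE; neq_simp.
have sym (s t : G) : (adjacent s t -> exists w, [/\ w \notin [:: u;
  v], adjacent s w & adjacent t w]) ->
    adjacent t s -> exists w, [/\ w \notin [:: u; v], adjacent t w & adjacent s w].
  by move=> st; rewrite adjC => /st[w [? ? ?]]; exists w.
move=> s t; rewrite !inE => /or3P[]/eqP-> /or3P[]/eqP->.
- by rewrite /adjacent multxx.
- exact: cone_pair u_nb v_nb'.
- exact: cone_pair u_nb2 v_nb2.
- by apply: sym; apply: cone_pair u_nb v_nb'.
- by rewrite /adjacent multxx.
- exact: cone_pair u_nb3 v_nb3.
- by apply: sym; apply: cone_pair u_nb2 v_nb2.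
- by apply: sym; apply: cone_pair u_nb3 v_nb3.
- by rewrite /adjacent multxx.
Qed.

End Simple.

Section SimpleLinks.
Variable G : multigraph.
Hypothesis G4 : regular 4 G.
Hypothesis G_tri : triangle_property G.
Hypothesis G_simple : forall x y : G, mult x y <= 1.

(** With [a] and [b] sharing the outer neighbour [a'], the vertices [c] and [d] must share [c'].
    After removing [vad], the triangles [vbc], [aba'] and [cdc'] cover all edges left at these five
    vertices. The case of [a'] equal to [c'] is the octahedron. *)
Lemma wheel_removable_aux (v a b c d a' : G) :
    adjacent b c -> adjacent c d -> mult a c = 0 -> mult b d = 0 ->
    nbrs v [:: a; b; c; d] -> nbrs a [:: v; b; d; a'] -> nbrs b [:: v; a; c; a'] ->
  exists e : block G, removable e.
Proof.
move=> bc cd ac0 bd0 v_nb a_nb b_nb.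
have vU := nbrs_uniq G_simple v_nb; neq_facts vU.
have vN := nbrs_neqs v_nb; neq_facts vN.
have aU := nbrs_uniq G_simple a_nb; neq_facts aU.
have bU := nbrs_uniq G_simple b_nb; neq_facts bU.
have aN := nbrs_neqs a_nb; neq_facts aN.
have bN := nbrs_neqs b_nb; neq_facts bN.
have [s c_nb] : exists s, nbrs c [:: v, b, d & s] by apply: nbrs_pick3; side.
have [c' E] := nbrs_rest1 G4 c_nb; subst s.
have [s d_nb] : exists s, nbrs d [:: v, a, c & s] by apply: nbrs_pick3; side.
have [d' E] := nbrs_rest1 G4 d_nb; subst s.
have cU := nbrs_uniq G_simple c_nb; neq_facts cU.
have dU := nbrs_uniq G_simple d_nb; neq_facts dU.
have cN := nbrs_neqs c_nb; neq_facts cN.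
have dN := nbrs_neqs d_nb; neq_facts dN.
have c'a : c' != a.
  by apply/eqP => E; move: ac0; rewrite multC c_nb E /= eqxx; neq_simp.
have d'b : d' != b.
  by apply/eqP => E; move: bd0; rewrite multC d_nb E /= eqxx; neq_simp.
have c'P : (a' == c') || (d' == c').
  have [|z] := tri_in (y := c') G_tri c_nb; first by rewrite !inE eqxx !orbT.
  by split_mem; known; case: (a' == c'); case: (d' == c').
have d'P : (a' == d') || (c' == d').
  have [|z] := tri_in (y := d') G_tri d_nb; first by rewrite !inE eqxx !orbT.
  by split_mem; known; case: (a' == d'); case: (c' == d').
have E : d' = c'.
  by case/orP: c'P => /eqP; [case/orP: d'P => /eqP <-|].
subst d'; have [E|a'c'] := eqVneq a' c'.
  by subst c'; exists (Tri v a d); removable_tac.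
by exists (Tri v a d); removable_tac.
Qed.

Lemma wheel_removable (v a b c d : G) :
    [&& adjacent a b, adjacent b c, adjacent c d & adjacent d a] ->
    nbrs v [:: a; b; c; d] ->
  exists e : block G, removable e.
Proof.
case/and4P => ab bc cd da v_nb; have vU := nbrs_uniq G_simple v_nb; neq_facts vU.
have vN := nbrs_neqs v_nb; neq_facts vN.
have [ac0|ac] := posnP (mult a c); last first.
  by apply: (cone_removable G4 G_tri G_simple v_nb ab ac); rewrite adjC.
have [bd0|bd] := posnP (mult b d); last first.
  have v_nb' : nbrs v [:: b; c; d; a] by reorder v_nb.
  by apply: (cone_removable G4 G_tri G_simple v_nb' bc bd); rewrite adjC.
have [s a_nb] : exists s, nbrs a [:: v, b, d & s] by apply: nbrs_pick3; side.
have [a' E] := nbrs_rest1 G4 a_nb; subst s.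
have [s b_nb] : exists s, nbrs b [:: v, a, c & s] by apply: nbrs_pick3; side.
have [b' E] := nbrs_rest1 G4 b_nb; subst s.
have [s d_nb] : exists s, nbrs d [:: v, a, c & s] by apply: nbrs_pick3; side.
have [d' E] := nbrs_rest1 G4 d_nb; subst s.
have aU := nbrs_uniq G_simple a_nb; neq_facts aU.
have aN := nbrs_neqs a_nb; neq_facts aN.
have a'c : a' != c.
  by apply/eqP => E; move: ac0; rewrite a_nb E /= eqxx; neq_simp.
(* The edge [aa'] has its triangle at [b] or at [d]; a reflection of the 4-cycle exchanges the
   two. *)
have [|z] := tri_in (y := a') G_tri a_nb; first by rewrite !inE eqxx !orbT.
split_mem; [by known | | | by rewrite /adjacent multxx].
- rewrite adjC (nbrs_adj _ b_nb) !inE; neq_simp; rewrite /= eq_sym => /eqP E; subst b'.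
  exact: wheel_removable_aux bc cd ac0 bd0 v_nb a_nb b_nb.
- rewrite adjC (nbrs_adj _ d_nb) !inE; neq_simp; rewrite /= eq_sym => /eqP E; subst d'.
  have v_nb' : nbrs v [:: a; d; c; b] by reorder v_nb.
  have a_nb' : nbrs a [:: v; d; b; a'] by reorder a_nb.
  rewrite multC in bd0; rewrite adjC in bc; rewrite adjC in cd.
  exact: wheel_removable_aux cd bc ac0 bd0 v_nb' a_nb' d_nb.
Qed.

(* The neighbours of p2 induce exactly the path p0-p1-p3-p4. *)
Definition strip (p0 p1 p2 p3 p4 : G) :=
  [&& adjacent p0 p1, adjacent p1 p3, adjacent p3 p4, ~~ adjacent p0 p3,
      ~~ adjacent p1 p4 & ~~ adjacent p0 p4] /\ nbrs p2 [:: p0; p1; p3; p4].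

Lemma strip_rev p0 p1 p2 p3 p4 : strip p0 p1 p2 p3 p4 -> strip p4 p3 p2 p1 p0.
Proof.
case=> /and5P[e1 e2 e3 e4 /andP[e5 e6]] nb; split; last by reorder nb.
by rewrite adjC e3 adjC e2 adjC e1 adjC e5 adjC e4 adjC e6.
Qed.

(** Here [b] and [c] share the outer neighbour [b']. If [a] and [b'] are not adjacent, [vab] can go,
    since [vcd] and [bcb'] cover what remains; otherwise the neighbours of [b] carry a 4-cycle. *)
Lemma strip_removable a b v c d b' : strip a b v c d ->
    nbrs b [:: v; a; c; b'] -> adjacent b' c ->
  exists e : block G, removable e.
Proof.
case=> /and5P[ab bc cd ac /andP[bd ad]] v_nb b_nb b'c.
have ac0 : mult a c = 0 by apply/eqP; rewrite eqn0Ngt.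
have bd0 : mult b d = 0 by apply/eqP; rewrite eqn0Ngt.
have ad0 : mult a d = 0 by apply/eqP; rewrite eqn0Ngt.
have vU := nbrs_uniq G_simple v_nb; neq_facts vU.
have vN := nbrs_neqs v_nb; neq_facts vN.
have bU := nbrs_uniq G_simple b_nb; neq_facts bU.
have bN := nbrs_neqs b_nb; neq_facts bN.
have b'd : b' != d.
  by apply/eqP => E; move: bd0; rewrite b_nb E /= eqxx; neq_simp.
have [s c_nb] : exists s, nbrs c [:: v, b, d & s] by apply: nbrs_pick3; side.
have [c' E] := nbrs_rest1 G4 c_nb; subst s.
have E : c' = b'.
  by move: b'c; rewrite adjC (nbrs_adj _ c_nb) !inE; neq_simp; rewrite eq_sym => /eqP.
subst c'; have [ab'0|ab'] := posnP (mult a b').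
  by exists (Tri v a b); removable_tac.
have b_nb' : nbrs b [:: a; v; c; b'] by reorder b_nb.
apply: wheel_removable b_nb'.
by rewrite (adjC c b') (adjC b' a) b'c /adjacent ab'; known.
Qed.

(** The edge from [p3] to its fourth neighbour has its triangle at [p1] or [p4]. The first case is
    [strip_removable] for the reversed strip; if it fails, that neighbour continues the strip as
    [p5]. *)
Lemma strip_step p0 p1 p2 p3 p4 : strip p0 p1 p2 p3 p4 ->
  (exists e : block G, removable e) \/ exists p5, strip p1 p2 p3 p4 p5.
Proof.
rename p0 into a, p1 into b, p2 into v, p3 into c, p4 into d => st.
have st' := strip_rev st.
case: st => /and5P[ab bc cd ac /andP[bd ad]] v_nb.
have vU := nbrs_uniq G_simple v_nb; neq_facts vU.
have vN := nbrs_neqs v_nb; neq_facts vN.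
have [s c_nb] : exists s, nbrs c [:: v, b, d & s] by apply: nbrs_pick3; side.
have [c' E] := nbrs_rest1 G4 c_nb; subst s.
have cU := nbrs_uniq G_simple c_nb; neq_facts cU.
have cN := nbrs_neqs c_nb; neq_facts cN.
have c'a : c' != a.
  by apply: contraNneq ac => <-; rewrite adjC (nbrs_adj _ c_nb) !inE eqxx !orbT.
have c_nb' : nbrs c [:: v; d; b; c'] by reorder c_nb.
have [c'b|c'b] := boolP (adjacent c' b).
  by left; apply: strip_removable st' c_nb' c'b.
have c'd : adjacent c' d.
  have [|z] := tri_in (y := c') G_tri c_nb; first by rewrite !inE eqxx !orbT.
  by split_mem; [known | rewrite (negPf c'b) | | rewrite /adjacent multxx].
right; exists c'; split; last by reorder c_nb.
rewrite (adjC d c') c'd (adjC b c') c'b bd.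
by known.
Qed.

Definition matching_link (v : G) := forall y z z' : G,
  adjacent v y -> adjacent v z -> adjacent v z' -> adjacent y z -> adjacent y z' ->
    z = z'.

Ltac adj_facts := repeat match goal with
  | H : adjacent ?x ?y = _ |- context [adjacent ?x ?y] => rewrite H
  end; done.

Ltac use_cone v p q r s :=
  solve [constructor 1; apply: (@cone_removable G G4 G_tri G_simple v p q r s);
  [ | adj_facts ..]; match goal with H : nbrs v _ |- _ => reorder H end].

Ltac use_wheel v p q r s :=
  solve [constructor 1; apply: (@wheel_removable v p q r s);
  [adj_facts | match goal with H : nbrs v _ |- _ => reorder H end]].

Ltac use_strip v p q r s :=
  solve [constructor 2; exists p, q, r, s; split;
  [adj_facts | match goal with H : nbrs v _ |- _ => reorder H end]].

Ltac use_matching H :=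
  solve [constructor 3;
    let y := fresh "y" in let z := fresh "z" in let z' := fresh "z'" in
  move=> y z z'; rewrite !(nbrs_adj _ H) !inE;
  repeat case/orP; move=> /eqP->; repeat case/orP; move=> /eqP->;
  repeat case/orP; move=> /eqP->; adj_facts].

Ltac link_tac v a b c d :=
  first [use_cone v a b c d | use_cone v b a c d | use_cone v c a b d | use_cone v
    d a b c
  | use_wheel v a b c d | use_wheel v a c b d | use_wheel v a b d c
  | use_strip v a b c d | use_strip v a b d c | use_strip v a c b d | use_strip v a
    c d b
  | use_strip v a d b c | use_strip v a d c b | use_strip v b a c d | use_strip v b
    a d c
  | use_strip v b c a d | use_strip v b d a c | use_strip v c a b d | use_strip v c
    b a d
  | match goal with H : nbrs v _ |- _ => use_matching H end].

(** A simple graph on four vertices without isolated vertices has a dominating vertex, contains a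
    4-cycle, is a path, or is a perfect matching. The proof runs through all 64 adjacency
    patterns. *)
Lemma link_cases (v : G) :
  [\/ exists e : block G, removable e, exists p0 p1 p3 p4,
    strip p0 p1 v p3 p4 | matching_link v].
Proof.
have [s v_nb] := nbrs_exists v; have := nbrs_size4 G4 v_nb.
case: s v_nb => [|a [|b [|c [|d []]]]] // v_nb _.
have tri y : y \in [:: a; b; c; d] -> has (adjacent y) [:: a; b; c; d].
  by move=> y_s; have [z ? ?] := tri_in (y := y) G_tri v_nb y_s; apply/hasP; exists z.
have Ta : has (adjacent a) [:: a; b; c; d] by apply: tri; rewrite !inE eqxx.
have Tb : has (adjacent b) [:: a; b; c; d] by apply: tri; rewrite !inE eqxx ?orbT.
have Tc : has (adjacent c) [:: a; b; c; d] by apply: tri; rewrite !inE eqxx ?orbT.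
have Td : has (adjacent d) [:: a; b; c; d] by apply: tri; rewrite !inE eqxx ?orbT.
clear tri.
have irr x : @adjacent G x x = false by rewrite /adjacent multxx.
rewrite /= !irr !orbF in Ta Tb Tc Td.
have ba : adjacent b a = adjacent a b by rewrite adjC.
have ca : adjacent c a = adjacent a c by rewrite adjC.
have da : adjacent d a = adjacent a d by rewrite adjC.
have cb : adjacent c b = adjacent b c by rewrite adjC.
have db : adjacent d b = adjacent b d by rewrite adjC.
have dc : adjacent d c = adjacent c d by rewrite adjC.
have irra := irr a; have irrb := irr b; have irrc := irr c; have irrd := irr d.
rewrite ?ba ?ca ?da ?cb ?db ?dc in Ta Tb Tc Td.
move: ba ca da cb db dc Ta Tb Tc Td.
case ab: (adjacent a b); case ac: (adjacent a c); case ad: (adjacent a d);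
case bc: (adjacent b c); case bd: (adjacent b d); case cd: (adjacent c d);
move=> ba ca da cb db dc //= _ _ _ _; link_tac v a b c d.
Qed.
End SimpleLinks.

(** * Squared cycles *)

Section StripCycle.
Variable G : multigraph.
Hypothesis G_conn : connected G.
Hypothesis G4 : regular 4 G.
Hypothesis G_simple : forall x y : G, mult x y <= 1.
Hypothesis strip_next : forall p0 p1 p2 p3 p4 : G,
  strip p0 p1 p2 p3 p4 -> exists p5, strip p1 p2 p3 p4 p5.

(** An induced path on four vertices is determined by its vertex set up to reversal. *)
Lemma strip_unique (a b v c d a' b' c' d' : G) :
    strip a b v c d -> strip a' b' v c' d' ->
  [/\ a' = a, b' = b, c' = c & d' = d] \/ [/\ a' = d, b' = c, c' = b & d' = a].
Proof.
case=> /and5P[ab bc cd /negbTE ac /andP[/negbTE bd /negbTE ad]] v_nb.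
case=> /and5P[a'b' b'c' c'd' /negbTE a'c' /andP[/negbTE b'd' /negbTE a'd']] v_nb'.
have irr (x : G) : adjacent x x = false by rewrite /adjacent multxx.
have mem x : x \in [:: a'; b'; c'; d'] -> [\/ x = a, x = b, x = c | x = d].
  rewrite -(nbrs_adj _ v_nb') (nbrs_adj _ v_nb) !inE.
  by case/or4P => /eqP->;
      [constructor 1 | constructor 2 | constructor 3 | constructor 4].
have ba : adjacent b a = true by rewrite adjC.
have ca : adjacent c a = false by rewrite adjC.
have da : adjacent d a = false by rewrite adjC.
have cb : adjacent c b = true by rewrite adjC.
have db : adjacent d b = false by rewrite adjC.
have dc : adjacent d c = true by rewrite adjC.
have irra := irr a; have irrb := irr b; have irrc := irr c; have irrd := irr d.
have [||||] := mem b'; rewrite ?inE ?eqxx ?orbT // => E; subst b';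
have [||||] := mem c'; rewrite ?inE ?eqxx ?orbT // => E; subst c';
  try congruence;
have [||||] := mem a'; rewrite ?inE ?eqxx ?orbT // => E; subst a';
  try congruence;
have [||||] := mem d'; rewrite ?inE ?eqxx ?orbT // => E; subst d';
  try congruence; by [left | right].
Qed.

(** A function is needed to iterate the extension of strips. On a strip the fourth neighbour of [p3]
    exists, so the default [p0] is never returned. *)
Definition strip_succ (p0 p1 p2 p3 p4 : G) : G :=
  odflt p0 [pick z | adjacent p3 z & z \notin [:: p1; p2; p4]].

Lemma strip_succP p0 p1 p2 p3 p4 : strip p0 p1 p2 p3 p4 ->
  strip p1 p2 p3 p4 (strip_succ p0 p1 p2 p3 p4).
Proof.
move=> /strip_next[p5 st]; rewrite /strip_succ.
have [_ nb] := st; have nbU := nbrs_uniq G_simple nb.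
case: pickP => [z /andP[]|/(_ p5)].
  rewrite (nbrs_adj _ nb) !inE => /or4P[]/eqP->; rewrite ?eqxx ?orbT //.
rewrite (nbrs_adj _ nb) !inE eqxx !orbT /=.
by neq_facts nbU; neq_simp.
Qed.

Variables s0 s1 s2 s3 s4 : G.
Hypothesis s_strip : strip s0 s1 s2 s3 s4.

Fixpoint strip_state n : G * G * G * G * G :=
  if n is n'.+1 then
    let: (p0, p1, p2, p3, p4) := strip_state n' in
    (p1, p2, p3, p4, strip_succ p0 p1 p2 p3 p4)
  else (s0, s1, s2, s3, s4).

Definition strip_seq n : G := (strip_state n).1.1.1.1.
Local Notation q := strip_seq.

Lemma strip_seqP n : strip (q n) (q n.+1) (q n.+2) (q n.+3) (q n.+4).
Proof.
rewrite /strip_seq /=.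
have : let: (p0, p1, p2, p3, p4) := strip_state n in strip p0 p1 p2 p3 p4.
  elim: n => //= n; case: (strip_state n) => [[[[p0 p1] p2] p3] p4].
  exact: strip_succP.
by case: (strip_state n) => [[[[p0 p1] p2] p3] p4].
Qed.

Lemma strip_seq_nbrs n : nbrs (q n.+2) [:: q n; q n.+1; q n.+3; q n.+4].
Proof. by case: (strip_seqP n). Qed.

Lemma strip_seq_neq1 n : q n != q n.+1.
Proof. by apply: adj_neq; case: (strip_seqP n) => /and5P[]. Qed.

Lemma strip_seq_neq2 n : q n != q n.+2.
Proof.
by rewrite eq_sym; apply: adj_neq; rewrite (nbrs_adj _ (strip_seq_nbrs n)) inE eqxx.
Qed.

Lemma strip_seq_cases i k : q i.+2 = q (i.+2 + k) ->
  [/\ q i = q (i + k), q i.+1 = q (i.+1 + k), q i.+3 = q (i.+3 + k) &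
    q i.+4 = q (i.+4 + k)]
  \/ q i.+3 = q (i.+1 + k).
Proof.
move=> E; have := strip_seqP (i + k); rewrite -!addSn -E => st.
by have [[]|[]] := strip_unique (strip_seqP i) st; [left | right].
Qed.

(* If q were traversed backwards from i + k + 3, then q (i + 2 + r) would equal
   q (i + k + 3 - r) for all r, and the two indices would become adjacent. *)
Lemma strip_seq_no_reversal k i : q i.+2 = q (i.+2 + k.+1) ->
  q i.+3 = q (i.+2 + k) -> False.
Proof.
have [n lt_n] := ubnP k; elim: n => // n IHn in k i lt_n *.
case: k lt_n => [|[|k]] lt_n E1 E2.
- by move: (strip_seq_neq1 i.+2); rewrite E1 addn1 eqxx.
- by move: (strip_seq_neq2 i.+2); rewrite E1 addn2 eqxx.
have E2' : q i.+3 = q (i.+3 + k.+1) by rewrite E2 addnS.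
have [[_ _ E _]|E] := strip_seq_cases E2'.
  (* Equal directions would identify [q (i + 4)] with [q (i + k + 5)], which is [q (i + 2)] by [E1],
     but these are adjacent. *)
  move: (strip_seq_neq2 i.+2); rewrite E E1 -addSnnS -addSnnS.
  by rewrite !addnS !addSn eqxx.
apply: (IHn k i.+1) E2' _; first exact: (@ltnW k.+1 n lt_n).
by rewrite E addnS addSn.
Qed.

Lemma strip_seq_shift i k : q i.+2 = q (i.+2 + k.+1) ->
  [/\ q i = q (i + k.+1), q i.+1 = q (i.+1 + k.+1), q i.+3 = q (i.+3 + k.+1)
    & q i.+4 = q (i.+4 + k.+1)].
Proof.
move=> E; have [//|E'] := strip_seq_cases E.
by case: (strip_seq_no_reversal E); rewrite E' addnS addSn.
Qed.

Local Notation p i := (q i.+2).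

(** The shift by two in [p] makes every [p i] the centre of a strip, so a coincidence propagates
    both forwards and backwards. *)
Lemma strip_seq_eq i k : (p i == p (i + k)) = (p 0 == p k).
Proof.
case: k => [|k]; first by rewrite addn0 !eqxx.
elim: i => // i <-; rewrite -!addSn.
apply/eqP/eqP => /strip_seq_shift[] //.
Qed.

Lemma strip_seq_period : exists2 n, 2 < n &
  forall i j, (p i == p j) = (i == j %[mod n]).
Proof.
have [n0 n0_gt0 p_n0] : exists2 n, 0 < n & p 0 == p n.
  have /injectivePn[i [j ij E]] : ~~ injectiveb (fun i : 'I_#|G|.+1 => p i).
    by apply/injectiveP => /leq_card; rewrite card_ord ltnn.
  wlog lt_ij : i j ij E / i < j.
    move=> IH; have := ij; rewrite -val_eqE neq_ltn => /orP[]; first exact: IH.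
    by apply: IH; rewrite // eq_sym.
  exists (j - i); first by rewrite subn_gt0.
  by rewrite -(strip_seq_eq i) subnKC ?E // ltnW.
have ex_n : exists n, (0 < n) && (p 0 == p n) by exists n0; rewrite n0_gt0.
case: (ex_minnP ex_n) => n /andP[n_gt0 p_n] n_min.
have p_add i k : p i = p (i + k * n).
  elim: k => [|k ->]; first by rewrite addn0.
  by apply/eqP; rewrite mulSnr addnA strip_seq_eq.
have p_mod i : p i = p (i %% n) by rewrite {1}(divn_eq i n) addnC -p_add.
exists n.
  case: n n_gt0 p_n {n_min p_add p_mod} => [|[|[|n]]] // _.
    by rewrite (negPf (strip_seq_neq1 2)).
  by rewrite (negPf (strip_seq_neq2 2)).
move=> i j; apply/eqP/eqP => [|ij]; last by rewrite p_mod ij -p_mod.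
wlog le_ij : i j / i <= j.
  by move=> IH; case/orP: (leq_total i j) => le_ij E; [|apply/esym]; apply: IH.
move=> /eqP; rewrite -{1}(subnKC le_ij) strip_seq_eq (p_mod (j - i)) => p_r.
have r0 : (j - i) %% n = 0.
  apply/eqP; rewrite -leqn0 leqNgt; apply/negP => r_gt0.
  by have := n_min ((j - i) %% n); rewrite r_gt0 p_r leqNgt ltn_pmod // => /(_ isT).
rewrite -(subnKC le_ij) -modnDmr r0 addn0 //.
Qed.

Lemma strip_sqcycle : exists n, 3 <= n /\ isomorphic G (sqcycle n).
Proof.
have [n n_gt2 pE] := strip_seq_period; exists n; split=> //.
have n_gt1 : 1 < n by apply: ltnW.
have pZ i j : (p i == p j) = ((i%:R : 'Z_n) == j%:R)%R.
  by rewrite pE -val_eqE /= !val_Zp_nat.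
pose f (i : 'Z_n) := p i.
have fE k : p k = f k%:R%R by apply/eqP; rewrite /f pZ natr_Zp.
have f_inj : injective f by move=> i j /eqP; rewrite /f pZ !natr_Zp => /eqP.
(* The neighbours of [p (m + 2)] are [p m], [p (m + 1)], [p (m + 3)] and [p (m + 4)]. Adding the
   period [n] before subtracting 2 makes such an [m] available for every residue. *)
have back (i : 'Z_n) : exists2 m, f i = p m.+2 & (i = m%:R + 2%:R)%R.
  have n_m : i + n = (i + n - 2).+2 by rewrite -[RHS]addn2 subnK // ltn_addl.
  exists (i + n - 2).
    by apply/eqP; rewrite -n_m /f pZ GRing.natrD pchar_Zp ?GRing.addr0.
  by rewrite -GRing.natrD addn2 -n_m GRing.natrD pchar_Zp ?GRing.addr0 ?natr_Zp.
have f_full x : x \in codom f.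
  apply: (connected_closed (x := p 0)) G_conn _ _ _; first by rewrite fE codom_f.
  move=> y z /codomP[i ->]; have [m -> _] := back i.
  rewrite (nbrs_adj _ (strip_seq_nbrs m.+2)) !inE.
  by case/or4P => /eqP->; rewrite fE codom_f.
apply: iso_sym; exists (f : sqcycle n -> G).
  apply: inj_card_bij => //.
  by rewrite -(card_codom f_inj); apply/subset_leq_card/subsetP.
move=> i j; rewrite /= /sqcycle_mult; have [->|ij] := eqVneq i j; first exact: multxx.
have [m -> iE] := back i; rewrite (strip_seq_nbrs m.+2) !fE /=.
rewrite !(inj_eq f_inj) iE.
have eqE (x y : 'Z_n) : (x == j - y)%R = (j == x + y)%R by rewrite eq_sym GRing.subr_eq.
rewrite !eqE ![_ == j]eq_sym.
have -> : (1 + (m%:R + 2) = m.+3%:R :> 'Z_n)%R by ring.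
have -> : (-1 + (m%:R + 2) = m.+1%:R :> 'Z_n)%R by ring.
have -> : (2 + (m%:R + 2) = m.+4%:R :> 'Z_n)%R by ring.
have -> : (- 2 + (m%:R + 2) = m%:R :> 'Z_n)%R by ring.
by case: (j == m%:R)%R; case: (j == m.+1%:R)%R; case: (j == m.+3%:R)%R;
  case: (j == m.+4%:R)%R.
Qed.
End StripCycle.

Section SimpleCases.
Variable G : multigraph.
Hypothesis G_conn : connected G.
Hypothesis G4 : regular 4 G.
Hypothesis G_tri : triangle_property G.
Hypothesis G_simple : forall x y : G, mult x y <= 1.

Lemma simple_cases :
  (exists e : block G, removable e) \/ exists n, 3 <= n /\ isomorphic G (sqcycle n).
Proof.
have [|irremovable] := classic (exists e : block G, removable e); first by left.
have next (p0 p1 p2 p3 p4 : G) : strip p0 p1 p2 p3 p4 ->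
  exists p5, strip p1 p2 p3 p4 p5.
  by case/(strip_step G4 G_tri G_simple).
have use_strip (v : G) : (exists p0 p1 p3 p4, strip p0 p1 v p3 p4) ->
    exists n, 3 <= n /\ isomorphic G (sqcycle n).
  by case=> p0 [p1 [p3 [p4 st]]];
      apply: strip_sqcycle G_conn G_simple next _ _ _ _ _ st.
have [/card_gt0P[v _] _] := G_conn.
have [//|st|v_match] := link_cases G4 G_tri G_simple v; first by right;
  apply: use_strip st.
have [s v_nb] := nbrs_exists v; have := nbrs_size4 G4 v_nb.
case: s v_nb => [|a s] // v_nb _.
have va : adjacent v a by rewrite (nbrs_adj _ v_nb) inE eqxx.
have [b [_ ab bv]] := G_tri va.
have [//|st|a_match] := link_cases G4 G_tri G_simple a; first by right;
  apply: use_strip st.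
have vb : adjacent v b by rewrite adjC.
have av : adjacent a v by rewrite adjC.
have ba : adjacent b a by rewrite adjC.
(* Every edge of this triangle has an end in [v] or [a], so the matchings at these two vertices show
   that no edge of it lies in a triangle with another third vertex. *)
left; exists (Tri v a b); apply: isolated_triangle_removable => // z.
- by move=> vz az; apply: (v_match a).
- by move=> az bz; apply: (a_match b).
- by move=> bz vz; apply: (v_match b).
Qed.
End SimpleCases.

(** * Removing all blocks *)

Section Peeling.
Variable G : multigraph.
Hypothesis G_conn : connected G.
Hypothesis G4 : regular 4 G.

Definition peeled (bs : seq (block G)) :=
  [/\ all block_wf bs, has_edges (edges_of bs)
    & triangle_property (remove_edges (edges_of bs))].

Lemma degree_remove_edges s (x : G) : loopless s -> has_edges s ->
  @degree (remove_edges s) x + count_mem x (endpoints s) = 4.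
Proof.
move=> s_loopless s_le; rewrite -(degree_list_graph x s_loopless) -big_split -(G4 x).
by apply: eq_bigr => y _; rewrite /= /remove_mult subnK.
Qed.

Lemma even_block_endpoints (T : eqType) (b : block T) x :
  odd (count_mem x (endpoints (block_edges b))) = false.
Proof.
by case: b => *; rewrite /= !oddD !oddb;
  repeat match goal with |- context [?y == x] => case: (y == x) end.
Qed.

Lemma even_endpoints (T : eqType) (bs : seq (block T)) x :
  odd (count_mem x (endpoints (edges_of bs))) = false.
Proof.
elim: bs => // b bs IHbs.
by rewrite /edges_of /= endpoints_cat count_cat oddD even_block_endpoints IHbs.
Qed.

Lemma size_endpoints (T : eqType) (s : seq (T * T)) : size (endpoints s) = (size s).*2.
Proof. by elim: s => //= p s; rewrite doubleS => <-. Qed.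

Lemma peeled_size bs : peeled bs -> size (edges_of bs) <= 4 * #|G|.
Proof.
case=> wf_bs le_bs _; have loops := edges_of_loopless wf_bs.
apply: leq_trans (_ : size (endpoints (edges_of bs)) <= _).
  by rewrite size_endpoints -addnn leq_addr.
have -> : size (endpoints (edges_of bs)) = \sum_(x : G) count_mem x (endpoints
  (edges_of bs)).
  elim: (endpoints _) => [|y t IHt] /=; first by rewrite big1.
  rewrite big_split /= -IHt -[LHS]add1n; congr (_ + _).
  by rewrite (bigD1 y) //= eqxx big1 // => z /negPf; rewrite eq_sym => ->.
rewrite mulnC -sum_nat_const; apply: leq_sum => x _.
by rewrite -(degree_remove_edges x loops le_bs) leq_addl.
Qed.

(* If no vertex has degree 2 in the rest, the vertices of degree 4 in the rest
   are closed under adjacency in G, so there are none. *)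
Lemma peeled_extend b bs : peeled (b :: bs) ->
  edge_count (edges_of (b :: bs)) =2 mult \/ exists c, peeled [:: c, b & bs].
Proof.
set cs := b :: bs => -[wf_cs le_cs R_tri]; set R := remove_edges (edges_of cs) in R_tri.
have loops := edges_of_loopless wf_cs.
have deg x := degree_remove_edges x loops le_cs.
(* Blocks have even degrees, so the rest keeps the parity of 4. *)
have R_even x : @degree R x \in [:: 0; 2; 4].
  move: (deg x) (even_endpoints cs x).
  by move: (degree _) (count_mem _ _) => [|[|[|[|[|d]]]]] [|[|[|[|[|c]]]]].
have [/existsP[v /eqP deg_v]|no2] := boolP [exists v, @degree R v == 2].
  right; have [c [wf_c le_c c_tri]] := peel R_even R_tri deg_v; exists c.
  have mE (x y : G) : @mult (@remove_edges G (edges_of ((c : block G) :: cs))) x y =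
      @mult (@remove_edges R (block_edges c)) x y.
    change (@mult G x y - edge_count (block_edges c ++ edges_of cs) x y =
      @mult G x y - edge_count (edges_of cs) x y - edge_count (block_edges c) x y).
    by rewrite edge_count_cat addnC subnDA.
  split=> [|x y|x y]; first by rewrite /= wf_c.
    rewrite [edges_of _]/(block_edges c ++ edges_of cs) edge_count_cat addnC.
    by rewrite -leq_subRL; [exact: le_c | exact: le_cs].
  rewrite /adjacent mE => /c_tri[z [xy yz zx]].
  by exists z; split; rewrite /adjacent mE.
left.
have deg04 x : @degree R x = 0 \/ @degree R x = 4.
  have := R_even x; move/existsPn: no2 => /(_ x) /negPf no2.
  by rewrite !inE no2 => /orP[]/eqP; [left | right].
have full x : @degree R x = 4 -> x \notin endpoints (edges_of cs).
  move=> deg_x; have := deg x; rewrite deg_x -{2}(addn0 4) => /addnI/eqP.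
  by rewrite eqn0Ngt -has_count has_pred1.
have none x : @degree R x = 0.
  have [//|deg_x] := deg04 x; exfalso.
  (* This is where the list must be nonempty: a vertex touched by a removed block cannot have degree
     4 in the rest. *)
  have [y y_cs] : exists y, y \in endpoints (edges_of cs).
    by rewrite /cs; case: (b) => y *; exists y; rewrite /edges_of /= !inE eqxx ?orbT.
  suff deg_y : @degree R y = 4 by move: (full y deg_y); rewrite y_cs.
  suff : y \in [seq z <- enum G | @degree R z == 4] by rewrite mem_filter =>
    /andP[/eqP].
  apply: (connected_closed (x := x : G) G_conn).
    by rewrite mem_filter deg_x mem_enum.
  move=> u v; rewrite mem_filter => /andP[/eqP deg_u _] uv;
    rewrite mem_filter mem_enum andbT.
  have [deg_v|->//] := deg04 v.
  have : @mult R u v <= @degree R v.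
    by rewrite multC /degree (bigD1 u) //= leq_addr.
  by rewrite deg_v leqn0 /= /remove_mult edge_count_out ?full // subn0 eqn0Ngt
      -/(adjacent u v) uv.
move=> x y; apply/eqP; rewrite eqn_leq le_cs -subn_eq0.
by rewrite -[_ - _]/(@mult R x y) -leqn0 -(none x) /degree (bigD1 y) //= leq_addr.
Qed.

Lemma peeled_complete b bs : peeled (b :: bs) ->
  exists cs, all block_wf cs /\ edge_count (edges_of cs) =2 @mult G.
Proof.
(* Every block adds at least one edge, and the degree sum bounds the number of removed edges,
   crudely, by [4 * #|G|]. *)
have [n] := ubnP (4 * #|G| - size (edges_of (b :: bs))).
elim: n => // n IHn in b bs *; rewrite ltnS => le_n bs_peeled.
have [E|[c cs_peeled]] := peeled_extend bs_peeled.
  by exists (b :: bs); split=> //; case: bs_peeled.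
apply: (IHn _ _ _ cs_peeled); apply: leq_trans le_n; apply: ltn_sub2l.
  apply: leq_trans (peeled_size cs_peeled).
  by rewrite /edges_of /= !size_cat; case: (c) => *; rewrite /= addSn ltnS leq_addl.
by rewrite /edges_of /= !size_cat; case: (c) => *; rewrite /= addSn ltnS leq_addl.
Qed.

Lemma removable_obtained (b : block G) : removable b ->
  exists M, regular 3 M /\ obtained_from (line_multigraph M) G.
Proof.
case=> wf_b le_b b_tri.
have E : edges_of [:: b] = block_edges b by rewrite /edges_of /= cats0.
have [|cs [wf_cs csE]] := @peeled_complete b [::].
  by split; rewrite ?E //= wf_b.
have [/card_gt0P[x _] _] := G_conn.
have [|M [M3 obt]] := blocks_obtained (x : vert G) wf_cs.
  by move=> y; rewrite -(G4 y); apply: eq_bigr => z _; rewrite -csE.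
exists M; split=> //; apply: obtained_from_iso obt _.
by exists id => [|y z]; [exists id | rewrite /= csE].
Qed.

End Peeling.

Theorem theorem1 (G : multigraph) (G_connected : connected G)
    (G_quartic : regular 4 G) (G_triangles : triangle_property G) :
  (exists n : nat, 3 <= n /\ isomorphic G (sqcycle n))
  \/ (isomorphic G F5 /\ operation4 (sqcycle 4) F5)
  \/ (exists M : multigraph,
        regular 3 M /\ obtained_from (line_multigraph M) G).
Proof.
have [/existsP[v /existsP[a va]]|simple] :=
  boolP [exists v : G, exists a : G, 1 < mult v a].
  have [[b rem_b]|iso|iso] := multi_edge_cases G_connected G_quartic G_triangles va.
  - by right; right; apply: removable_obtained rem_b.
  - by left; exists 4.
  - by right; left; split; last exact: operation4_F5.
have G_simple (x y : G) : mult x y <= 1.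
  by rewrite leqNgt; move/existsPn: simple => /(_ x) /existsPn/(_ y).
have [[b rem_b]|] := simple_cases G_connected G_quartic G_triangles G_simple;
  last by left.
by right; right; apply: removable_obtained rem_b.
Qed.
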